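(* Let $l=(l_1,l_2)\in\mathbb{R}^2_{>0}$, let $\Gamma_l=(l_1\mathbb{Z})\times(l_2\mathbb{Z})$ and set $\mathbb{T}_l=\mathbb{R}^2/\Gamma_l$. Let $\{\psi_n\}_{n\in\Gamma_l^*}$ be an orthonormal basis of $L^2(\mathbb{T}_l)$ consisting of eigenfunctions of the Laplace–Beltrami operator $-\Delta_{\mathbb{T}_l}$, with corresponding eigenvalues $\{\lambda_n^2\}_{n\in\Gamma_l^*}$ (so $-\Delta_{\mathbb{T}_l}\psi_n=\lambda_n^2\psi_n$, $\lambda_n\ge0$). Then for any $a\in L^2(\mathbb{T}_l)$ the following three properties hold. (1) $$\lim_{\lambda\to\infty}\frac{1}{\mathcal{N}(\sqrt{-\Delta_{\mathbb{T}_l}},\lambda)}\sum_{\lambda_n\le\lambda}\Big|\langle a\psi_n,\psi_n\rangle-\frac{1}{\operatorname{area}(\mathbb{T}_l)}\int_{\mathbb{T}_l}a(x)\,dx\Big|^2=0.$$ (2) For every $\varepsilon>0$ there exists $\delta(\varepsilon)>0$ such that $$\limsup_{\lambda\to\infty}\frac{1}{\mathcal{N}(\sqrt{-\Delta_{\mathbb{T}_l}},\lambda)}\sum_{\substack{j\ne k:\ \lambda_j,\lambda_k\le\lambda\\ |\lambda_j-\lambda_k|<\delta(\varepsilon)}}\big|\langle a\psi_j,\psi_k\rangle\big|^2<\varepsilon.$$ (3) For every $\varepsilon>0$ there exists $\delta(\varepsilon)>0$ such that for all $\tau\in\mathbb{R}$ $$\limsup_{\lambda\to\infty}\frac{1}{\mathcal{N}(\sqrt{-\Delta_{\mathbb{T}_l}},\lambda)}\sum_{\substack{j\ne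 k:\ \lambda_j,\lambda_k\le\lambda\\ |\lambda_j-\lambda_k-\tau|<\delta(\varepsilon)}}\big|\langle a\psi_j,\psi_k\rangle\big|^2<\varepsilon.$$
   Context: $\Gamma_l^*$ is the dual lattice $\{k\in\mathbb{R}^2:\langle k,x\rangle\in\mathbb{Z}\text{ for all }x\in\Gamma_l\}=(l_1^{-1}\mathbb{Z})\times(l_2^{-1}\mathbb{Z})$, used as index set for the eigenbasis. $\langle a\psi_j,\psi_k\rangle=\int_{\mathbb{T}_l}a\,\psi_j\overline{\psi_k}\,dx$. $\mathcal{N}(\sqrt{-\Delta_{\mathbb{T}_l}},\lambda)$ is the number of eigenvalues of $\sqrt{-\Delta_{\mathbb{T}_l}}$ (i.e. of the $\lambda_n$, counted with multiplicity) that are less than or equal to $\lambda$. The double sums run over ordered pairs $(j,k)$ of indices in $\Gamma_l^*$ with $j\ne k$. *)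

(* Defs.v *)
From HB Require Import structures.
From mathcomp Require Import all_boot all_order all_algebra.
From mathcomp Require Import finmap.
From mathcomp Require Import all_classical all_reals all_analysis.
From mathcomp Require Import complex.

Set Implicit Arguments.
Unset Strict Implicit.
Unset Printing Implicit Defensive.

Import Order.TTheory GRing.Theory Num.Theory.
Import numFieldNormedType.Exports.
Import Normc.

Local Open Scope classical_set_scope.
Local Open Scope ring_scope.
Local Open Scope complex_scope.

Section FlatTorus.
Variables (R : realType) (l : R * R).

Definition lattice : set (R * R) :=
  [set x | exists m n : int, x = (l.1 * m%:~R, l.2 * n%:~R)].

Definition dual_lattice : set (R * R) :=
  [set k | forall x, lattice x -> k.1 * x.1 + k.2 * x.2 \is a Num.int].

(* A function on the torus [R^2 / lattice] is represented by its lift to [R^2],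
   i.e. by a function on the plane invariant under translations by the
   lattice. *)
Definition torus_function (T : Type) (f : R * R -> T) : Prop :=
  forall x g, lattice g -> f (x + g) = f x.

Definition fundamental_domain : set (R * R) :=
  `[0, l.1[%classic `*` `[0, l.2[%classic.

Definition plane_measure := (@lebesgue_measure R \x @lebesgue_measure R)%E.

Definition torus_area : R := fine (plane_measure fundamental_domain).

(* [complex R] carries no measurable structure: measurability and integrals are
   taken on real and imaginary parts. *)
Definition torus_integral (f : R * R -> R[i]) : R[i] :=
  (\int[plane_measure]_(x in fundamental_domain) complex.Re (f x)) +i*
  (\int[plane_measure]_(x in fundamental_domain) complex.Im (f x)).

Definition torus_inner (f g : R * R -> R[i]) : R[i] :=
  torus_integral (fun x => f x * (g x)^*).

Definition torus_normsq (f : R * R -> R[i]) : \bar R :=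
  (\int[plane_measure]_(x in fundamental_domain) (normc (f x) ^+ 2)%:E)%E.

Definition torus_L2 (f : R * R -> R[i]) : Prop :=
  [/\ torus_function f,
      measurable_fun [set: measurableTypeR R * measurableTypeR R]
        (fun x => complex.Re (f x)),
      measurable_fun [set: measurableTypeR R * measurableTypeR R]
        (fun x => complex.Im (f x)) &
      (torus_normsq f < +oo)%E].

Definition orthonormal_basis (I : eqType) (psi : I -> R * R -> R[i]) : Prop :=
  [/\ forall n, torus_L2 (psi n),
      forall m n, torus_inner (psi m) (psi n) = (m == n)%:R &
      forall f, torus_L2 f -> forall eps : R, 0 < eps ->
        exists (s : seq I) (c : I -> R[i]),
          (torus_normsq (fun x => f x - \sum_(n <- s) c n * psi n x)%R
           < eps%:E)%E].

Definition e1 : R * R := (1, 0).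
Definition e2 : R * R := (0, 1).

Definition C1_plane (u : R * R -> R) : Prop :=
  continuous u /\
  forall v, v = e1 \/ v = e2 ->
    (forall x, derivable u x v) /\ continuous (fun x => 'D_v u x).

Definition C2_plane (u : R * R -> R) : Prop :=
  C1_plane u /\ forall v, v = e1 \/ v = e2 -> C1_plane (fun x => 'D_v u x).

Definition laplacian_plane (u : R * R -> R) (x : R * R) : R :=
  'D_e1 (fun y => 'D_e1 u y) x + 'D_e2 (fun y => 'D_e2 u y) x.

(* In the flat coordinates of [R^2 / lattice] the Laplace-Beltrami operator is
   the Euclidean Laplacian. *)
Definition laplacian (f : R * R -> R[i]) (x : R * R) : R[i] :=
  laplacian_plane (fun y => complex.Re (f y)) x +i*
  laplacian_plane (fun y => complex.Im (f y)) x.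

Definition laplace_eigenfunction (f : R * R -> R[i]) (mu : R) : Prop :=
  [/\ torus_function f,
      C2_plane (fun x => complex.Re (f x)),
      C2_plane (fun x => complex.Im (f x)),
      exists x, f x != 0 &
      forall x, - laplacian f x = mu%:C * f x].

End FlatTorus.

Section SpectralSums.
Variables (R : realType) (I : choiceType) (lam : I -> R).

(* For the eigenvalues of a torus this set is finite (the spectrum is
   discrete with finite multiplicities), so [fset_set] does not take its default
   value; likewise for the sums over such index sets. *)
Definition eigenvalue_count (Lam : R) : nat := #|` fset_set [set n | lam n <= Lam] |.

End SpectralSums.

(* Main.v *)
(* Write [e_k] for the normalized exponentials and [U n k = <psi_n, e_k>].
   Green's identity gives [U n k = 0] unless [lam_n] is the frequency of [e_k];
   since a continuous function with vanishing Fourier coefficients is zero, each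
   [psi_n] is a finite sum of exponentials of frequency [lam_n].  The matrix [U]
   restricted to frequencies at most [T] is a contraction on both sides, hence
   the sum of [|<b psi_i, psi_j>|^2] over [|lam_i - lam_j - tau| < delta] is at
   most the sum of [|<b e_k, e_m>|^2] over pairs of frequencies satisfying the
   same condition, and [<b e_k, e_m>] is a multiple of the Fourier coefficient
   of [b] at [m - k].  By Bessel's inequality it is enough to bound, for each
   fixed shift [h <> 0], the number of [k] in a large ball such that
   [| |k| - |k + h| - tau | < delta].  Away from a strip around the line through
   [0] and [h], [|k + h| - |k|] grows along lines parallel to [h] at a rate
   bounded below, so many translates of the set of these [k] by multiples of [h]
   are disjoint and the set is sparse, uniformly in [tau]; the strip is sparse by
   translation across it.  The three claims follow with [b = a] minus its
   mean. *)

(* The basis is arbitrary inside each eigenspace, so a single <b psi_i, psi_j> cannot be compared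
   with a Fourier coefficient; only sums over a whole spectral window can. The comparison respects
   windows because [U] never mixes frequencies. All three claims are one estimate. Once the mean is
   removed, the diagonal pairs are among those with |lam_i - lam_j - 0| < delta, which gives (1),
   and (2) is (3) at tau = 0. Removing the mean also eliminates the shift h = 0, for which the
   condition reads |tau| < delta and, at tau = 0, selects every k. Uniformity in tau comes from
   comparing the condition at two points of one line, where tau cancels. A square integrable b has
   infinitely many shifts, and the threshold radius obtained for h grows with |h|. Hence the
   coefficients are cut into a finite set of shifts, which share one delta and one threshold, and a
   tail that is small in square sum and calls for no counting. *)
Require Import Defs.
From HB Require Import structures.
From mathcomp Require Import all_boot all_order all_algebra.
From mathcomp Require Import finmap.
From mathcomp Require Import all_classical all_reals all_analysis.
From mathcomp Require Import complex measurable_realfun.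
From mathcomp Require Import ring lra zify.
Import Order.TTheory GRing.Theory Num.Theory.
Import numFieldNormedType.Exports.
Import Normc.
Local Open Scope classical_set_scope.
Local Open Scope ring_scope.
Local Open Scope complex_scope.

Set Implicit Arguments.
Unset Strict Implicit.

(** * Integration over the fundamental domain *)

Section PlaneMeasure.
Variable R : realType.
Local Notation mR := (measurableTypeR R).
Local Notation leb := (@lebesgue_measure R).

(** Links the topology of the plane to the product sigma-algebra through second countability: an
    open set is the countable union of the rational boxes that it contains. *)
Lemma open_plane_measurable (A : set (R * R)) :
  open A -> measurable (A : set (mR * mR)).
Proof.
move=> oA.
pose box (q : (rat * rat) * (rat * rat)) : set (mR * mR) :=
  `]ratr q.1.1, ratr q.1.2[ `*` `]ratr q.2.1, ratr q.2.2[.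
have -> : A = \bigcup_(q in [set q | box q `<=` A]) box q.
  apply/seteqP; split=> [[x y] Axy|z [q qA /qA//]].
  have /nbhs_ballP[e/= e0 eA] : nbhs (x, y) A by exact: open_nbhs_nbhs.
  have near_rat (t : R) : exists p : rat * rat,
      [/\ t - e < ratr p.1, ratr p.1 < t, t < ratr p.2 & ratr p.2 < t + e].
    have /rat_in_itvoo[p1] : t - e < t by rewrite ltrBlDr ltrDl.
    have /rat_in_itvoo[p2] : t < t + e by rewrite ltrDl.
    rewrite !in_itv /= => /andP[? ?] /andP[? ?].
    by exists (p1, p2).
  have [p [p1 p2 p3 p4]] := near_rat x; have [q [q1 q2 q3 q4]] := near_rat y.
  exists (p, q); last by split; rewrite /= in_itv/= ?p2 ?p3 ?q2 ?q3.
  move=> [u v] [/=]; rewrite !in_itv/= => /andP[u1 u2] /andP[v1 v2].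
  apply: eA; split; rewrite /ball/= ltr_distlC.
    by rewrite (lt_trans p1)//= (lt_trans u2).
  by rewrite (lt_trans q1)//= (lt_trans v2).
rewrite bigcup_mkcond; apply: countable_bigcupT_measurable => [|q].
  exact: countableP.
by case: ifP => // _; apply: measurableX; exact: measurable_itv.
Qed.

Lemma continuous_plane_measurable (f : R * R -> R) :
  continuous f -> measurable_fun [set: mR * mR] f.
Proof.
move=> cf; apply: (measurability _ (RGenOInfty.measurableE R)) => //.
move=> _ [_ [a ->] <-]; rewrite setTI; apply: open_plane_measurable.
by move: cf => /continuousP; apply; exact: interval_open.
Qed.

End PlaneMeasure.

Section Torus.
Variables (R : realType) (l : R * R).
Hypotheses (l1_gt0 : 0 < l.1) (l2_gt0 : 0 < l.2).
Local Notation mR := (measurableTypeR R).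
Local Notation leb := (@lebesgue_measure R).
Local Notation mu := (leb \x leb)%E.
Local Notation D := (fundamental_domain l).

Lemma measurable_fundamental_domain : measurable (D : set (mR * mR)).
Proof. by apply: measurableX; exact: measurable_itv. Qed.

Lemma fundamental_domain_measure : mu (D : set (mR * mR)) = (l.1 * l.2)%:E.
Proof.
rewrite /fundamental_domain product_measure1E //=.
by rewrite !lebesgue_measure_itv/= !lte_fin l1_gt0 l2_gt0 !oppr0 !adde0.
Qed.

Lemma torus_areaE : torus_area l = l.1 * l.2.
Proof. by rewrite /torus_area /plane_measure fundamental_domain_measure. Qed.

Lemma continuous_plane_bounded (f : R * R -> R) : continuous f ->
  exists2 M, 0 < M & forall x, D x -> `|f x| <= M.
Proof.
move=> cf.
have cK : compact (`[0, l.1] `*` `[0, l.2] : set (R * R)).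
  by apply: compact_setX; exact: segment_compact.
have /compact_bounded[M [_ MK]] := @continuous_compact _ _ f _
  (continuous_subspaceT cf) cK.
(* Compactness gives the bound only for reals beyond [M], which may be negative; [|M| + 1] lies
   beyond it and is positive. The compact set is the closed rectangle, since [D] is half open. *)
exists (`|M| + 1); first by rewrite ltr_wpDl.
move=> -[x y] [/=]; rewrite !in_itv/= => /andP[x0 xl] /andP[y0 yl].
apply: (MK (`|M| + 1)); first by rewrite ltr_pwDr// ler_norm.
by exists (x, y) => //; split; rewrite /= in_itv/= ?x0 ?y0 ltW.
Qed.

Lemma bounded_torus_integrable (f : R * R -> R) M :
  measurable_fun [set: mR * mR] f -> (forall x, D x -> `|f x| <= M) ->
  mu.-integrable D (EFin \o f).
Proof.
move=> mf fM; apply: measurable_bounded_integrable.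
- exact: measurable_fundamental_domain.
- have /= := fundamental_domain_measure; rewrite /product_measure1 => ->.
  exact: ltry.
- exact: measurable_funTS.
- exists M; split; first exact: num_real.
  by move=> N MN x Dx; apply: le_trans (fM _ Dx) (ltW MN).
Qed.

Lemma continuous_torus_integrable (f : R * R -> R) :
  continuous f -> mu.-integrable D (EFin \o f).
Proof.
move=> cf; have [M _ fM] := continuous_plane_bounded cf.
exact: bounded_torus_integrable (continuous_plane_measurable cf) fM.
Qed.

(** Reduces the half of Green's identity in the first coordinate to one variable; the next lemma
    does the same for the second. *)
Lemma fubini_slices1_eq0 (f : R * R -> R) : continuous f ->
  (forall y, (\int[leb]_(x in `[0%R, l.1[) (f (x, y))%:E = 0)%E) ->
  \int[mu]_(x in D) f x = 0.
Proof.
move=> cf f0; rewrite /Rintegral integral_mkcond.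
rewrite -integral21_prod_meas1/=; last first.
  apply/(integrable_mkcond _ measurable_fundamental_domain).
  exact: continuous_torus_integrable.
rewrite /fubini_G integral0_eq//= => y _.
have [yl|yl] := pselect (`[0, l.2[%classic y); last first.
  by rewrite integral0_eq// => x _; rewrite patchE memNset// => -[/=].
rewrite -[RHS](f0 y) [RHS]integral_mkcond; apply: eq_integral => x _.
rewrite !patchE; congr (if _ then _ else _).
by apply/idP/idP; rewrite !inE; [case|split].
Qed.

Lemma fubini_slices2_eq0 (f : R * R -> R) : continuous f ->
  (forall x, (\int[leb]_(y in `[0%R, l.2[) (f (x, y))%:E = 0)%E) ->
  \int[mu]_(x in D) f x = 0.
Proof.
move=> cf f0; rewrite /Rintegral integral_mkcond.
rewrite -integral12_prod_meas1/=; last first.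
  apply/(integrable_mkcond _ measurable_fundamental_domain).
  exact: continuous_torus_integrable.
rewrite /fubini_F integral0_eq//= => x _.
have [xl|xl] := pselect (`[0, l.1[%classic x); last first.
  by rewrite integral0_eq// => y _; rewrite patchE memNset// => -[/=].
rewrite -[RHS](f0 x) [RHS]integral_mkcond; apply: eq_integral => y _.
rewrite !patchE; congr (if _ then _ else _).
by apply/idP/idP; rewrite !inE; [case|split].
Qed.

End Torus.

(** * Real plane waves and Green's identity *)

Section Slices.
Variable R : realType.
Implicit Types u : R * R -> R.

Lemma slice1_continuous u y : continuous u -> continuous (fun t => u (t, y)).
Proof.
move=> cu x; apply: (cvg_comp (fun t => (t, y)) u _ (cu (x, y))).
exact: (cvg_pair cvg_id (cvg_cst y)).
Qed.

Lemma slice2_continuous u x : continuous u -> continuous (fun t => u (x, t)).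
Proof.
move=> cu y; apply: (cvg_comp (fun t => (x, t)) u _ (cu (x, y))).
exact: (cvg_pair (cvg_cst x) cvg_id).
Qed.

Lemma slice1_is_derive u x y : derivable u (x, y) (e1 R) ->
  is_derive x 1 (fun t => u (t, y)) ('D_(e1 R) u (x, y)).
Proof.
move=> du.
have E : (fun h : R => h^-1 *: (u (h *: 1 + x, y) - u (x, y))) =
         (fun h : R => h^-1 *: (u (h *: e1 R + (x, y)) - u (x, y))).
  apply/funext => h; have -> // : h *: e1 R + (x, y) = (h *: 1 + x, y).
  by rewrite -[in RHS](add0r y) -[in RHS](mulr0 h).
by split; rewrite ?/derivable ?/derive E.
Qed.

Lemma slice2_is_derive u x y : derivable u (x, y) (e2 R) ->
  is_derive y 1 (fun t => u (x, t)) ('D_(e2 R) u (x, y)).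
Proof.
move=> du.
have E : (fun h : R => h^-1 *: (u (x, h *: 1 + y) - u (x, y))) =
         (fun h : R => h^-1 *: (u (h *: e2 R + (x, y)) - u (x, y))).
  apply/funext => h; have -> // : h *: e2 R + (x, y) = (x, h *: 1 + y).
  by rewrite -[in RHS](add0r x) -[in RHS](mulr0 h).
by split; rewrite ?/derivable ?/derive E.
Qed.

Lemma torus_function_derive (l : R * R) u v :
  torus_function l u -> torus_function l (fun x => 'D_v u x).
Proof.
move=> pu x g lg; rewrite /derive.
have -> // : (fun h : R => h^-1 *: (u (h *: v + (x + g)) - u (x + g))) =
             (fun h : R => h^-1 *: (u (h *: v + x) - u x)).
by apply/funext => h; rewrite (addrA _ x g) !(pu _ g lg).
Qed.

Lemma lattice_e1 (l : R * R) : lattice l (l.1, 0).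
Proof. by exists 1, 0; rewrite mulr1 mulr0. Qed.

Lemma lattice_e2 (l : R * R) : lattice l (0, l.2).
Proof. by exists 0, 1; rewrite mulr1 mulr0. Qed.

Lemma torus_function_slice1 (l : R * R) u y :
  torus_function l u -> u (l.1, y) = u (0, y).
Proof.
move=> pu; rewrite -[RHS](pu _ _ (lattice_e1 l)); congr u.
by rewrite -[in LHS](add0r l.1) -[in LHS](addr0 y).
Qed.

Lemma torus_function_slice2 (l : R * R) u x :
  torus_function l u -> u (x, l.2) = u (x, 0).
Proof.
move=> pu; rewrite -[RHS](pu _ _ (lattice_e2 l)); congr u.
by rewrite -[in LHS](add0r l.2) -[in LHS](addr0 x).
Qed.

(** The integrand is the derivative of the Wronskian u' v - u v', which takes the same value at 0
    and at [L] by periodicity. *)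
Lemma integral_green_1d (L : R) (u u' u'' v v' v'' : R -> R) : 0 < L ->
  (forall x : R, is_derive x 1 u (u' x)) ->
  (forall x : R, is_derive x 1 u' (u'' x)) ->
  (forall x : R, is_derive x 1 v (v' x)) ->
  (forall x : R, is_derive x 1 v' (v'' x)) ->
  continuous u'' -> continuous v'' ->
  u L = u 0 -> u' L = u' 0 -> v L = v 0 -> v' L = v' 0 ->
  (\int[@lebesgue_measure R]_(x in `[0%R, L[)
     (u'' x * v x - u x * v'' x)%:E = 0)%E.
Proof.
move=> L0 du du' dv dv' cu cv uL u'L vL v'L.
pose F x := u' x * v x - u x * v' x.
pose f x := u'' x * v x - u x * v'' x.
have dF (x : R) : is_derive x 1 F (f x).
  have /= H := is_deriveB (is_deriveM (du' x) (dv x)) (is_deriveM (du x) (dv'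
    x)).
  apply: is_derive_eq H _; rewrite /f /GRing.scale/=; ring.
have cont (g g' : R -> R) : (forall x : R, is_derive x 1 g (g' x)) ->
  continuous g.
  by move=> dg x; apply/differentiable_continuous/derivable1_diffP;
    case: (dg x).
have cf : continuous f.
  move=> x; apply: cvgB; apply: cvgM; first exact: cu.
  - exact: cont dv x.
  - exact: cont du x.
  - exact: cv.
rewrite integral_itv_bndo_bndc//; last first.
  apply/measurable_EFinP; apply: measurable_funTS.
  exact: continuous_measurable_fun.
rewrite (@continuous_FTC2 _ f F)//.
- by rewrite -EFinB /F uL u'L vL v'L subrr.
- exact: continuous_subspaceT.
- split.
  + by move=> x _; case: (dF x).
  + by apply: cvg_at_right_filter; exact: cont dF _.
  + by apply: cvg_at_left_filter; exact: cont dF _.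
- by move=> x _; rewrite derive1E; apply: derive_val.
Qed.

End Slices.

Section Waves.
Variables (R : realType) (l : R * R).
Hypotheses (l1_gt0 : 0 < l.1) (l2_gt0 : 0 < l.2).
Local Notation mR := (measurableTypeR R).
Local Notation leb := (@lebesgue_measure R).
Local Notation mu := (leb \x leb)%E.
Local Notation D := (fundamental_domain l).
Local Notation J := (int * int)%type.

(* [(omega1 k, omega2 k)] is [2 pi] times a point of the dual lattice. *)
Definition omega1 (k : J) : R := 2 * pi * k.1%:~R / l.1.
Definition omega2 (k : J) : R := 2 * pi * k.2%:~R / l.2.
Definition omegasq (k : J) : R := omega1 k ^+ 2 + omega2 k ^+ 2.

Definition phase (k : J) (x : R * R) : R := omega1 k * x.1 + omega2 k * x.2.
(* The free phase makes [wave] cover both the cosines and the sines. *)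
Definition wave (k : J) (phi : R) (x : R * R) : R := cos (phase k x + phi).

Lemma cos_add2piz (x : R) (n : int) : cos (x + 2 * pi * n%:~R) = cos x.
Proof.
have H (y : R) (m : nat) : cos (y + 2 * pi * m%:R) = cos y.
  rewrite -[RHS](periodicn (@cosD2pi R) m); congr cos.
  by rewrite -mulr_natr mulrAC -mulr_natl -mulr_natr; ring.
case: n => n; first exact: H.
by rewrite NegzE mulrNz mulrN -[LHS](H _ n.+1) subrK.
Qed.

Lemma omega1M (k : J) (m : int) :
  omega1 k * (l.1 * m%:~R) = 2 * pi * (k.1 * m)%:~R.
Proof. by rewrite /omega1 intrM; field; rewrite gt_eqF. Qed.

Lemma omega2M (k : J) (m : int) :
  omega2 k * (l.2 * m%:~R) = 2 * pi * (k.2 * m)%:~R.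
Proof. by rewrite /omega2 intrM; field; rewrite gt_eqF. Qed.

Lemma wave_torus_function k phi : torus_function l (wave k phi).
Proof.
move=> x _ [m [n ->]]; rewrite /wave /phase/= !mulrDr omega1M omega2M.
rewrite -[RHS](cos_add2piz _ (k.1 * m + k.2 * n)) intrD; congr cos; ring.
Qed.

Lemma wave_continuous k phi : continuous (wave k phi).
Proof.
move=> x; apply: continuous_comp; last exact: continuous_cos.
apply: cvgD; last exact: cvg_cst.
by apply: cvgD; apply: cvgM; try exact: cvg_cst;
  [exact: cvg_fst|exact: cvg_snd].
Qed.

Lemma affine_is_derive (a b x : R) :
  is_derive x 1 (fun t : R => a * t + b) a.
Proof.
have /= H := is_deriveD (is_deriveM (is_derive_cst a x 1) (is_derive_id x 1))
  (is_derive_cst b x 1).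
by apply: is_derive_eq H _; rewrite /GRing.scale/= !mulr0 !addr0 mulr1.
Qed.

Lemma cos_affine_is_derive (a b x : R) :
  is_derive x 1 (fun t : R => cos (a * t + b)) (- a * sin (a * x + b)).
Proof.
have H := affine_is_derive a b x.
have -> : (fun t : R => cos (a * t + b)) = cos \o (fun t => a * t + b) by [].
by apply: is_derive_eq; rewrite /GRing.scale/= mulrC mulrN mulNr.
Qed.

Lemma sin_affine_is_derive (a b x : R) :
  is_derive x 1 (fun t : R => - a * sin (a * t + b))
    (- a ^+ 2 * cos (a * x + b)).
Proof.
have H := affine_is_derive a b x.
have H2 : is_derive x 1 (sin \o (fun t => a * t + b)) (cos (a * x + b) * a).
  exact: is_derive1_comp.
have /= := is_deriveM (is_derive_cst (- a) x 1) H2.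
by move=> H3; apply: is_derive_eq H3 _; rewrite /GRing.scale/= mulr0 addr0;
  ring.
Qed.

Lemma wave_green (u : R * R -> R) k phi :
  torus_function l u -> C2_plane u ->
  \int[mu]_(x in D)
    (laplacian_plane u x * wave k phi x + omegasq k * u x * wave k phi x) = 0.
Proof.
move=> pu [[cu du] d2u].
have [du1 cu1] := du _ (or_introl erefl); have [du2 cu2] := du _ (or_intror
  erefl).
have [cu11 /(_ _ (or_introl erefl))[du11 cu11']] := d2u _ (or_introl erefl).
have [cu22 /(_ _ (or_intror erefl))[du22 cu22']] := d2u _ (or_intror erefl).
have cw := @wave_continuous k phi.
(* [f1] and [f2] are the integrands u'' w - u w'' in each coordinate, with w'' already replaced by
   minus the squared frequency times w. *)
pose f1 x := 'D_(e1 R) (fun y => 'D_(e1 R) u y) x * wave k phi x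
  - u x * (- omega1 k ^+ 2 * wave k phi x).
pose f2 x := 'D_(e2 R) (fun y => 'D_(e2 R) u y) x * wave k phi x
  - u x * (- omega2 k ^+ 2 * wave k phi x).
have cf1 : continuous f1.
  move=> x; apply: cvgB; apply: cvgM; first exact: cu11'.
  - exact: cw.
  - exact: cu.
  - by apply: cvgM; [exact: cvg_cst|exact: cw].
have cf2 : continuous f2.
  move=> x; apply: cvgB; apply: cvgM; first exact: cu22'.
  - exact: cw.
  - exact: cu.
  - by apply: cvgM; [exact: cvg_cst|exact: cw].
transitivity (\int[mu]_(x in D) (f1 x + f2 x)).
  apply: eq_Rintegral => x _; rewrite /f1 /f2 /laplacian_plane /omegasq.
  move: ('D_(e1 R) _ x) ('D_(e2 R) _ x) (wave k phi x) (u x) => a b w c.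
  by move: (omega1 k) (omega2 k) => p q; ring.
rewrite RintegralD; last 3 first.
- exact: measurable_fundamental_domain.
- exact: continuous_torus_integrable.
- exact: continuous_torus_integrable.
rewrite fubini_slices1_eq0//; last first.
  move=> y; have E t : wave k phi (t, y) = cos (omega1 k * t + (omega2 k * y +
    phi)).
    by rewrite /wave /phase/= addrA.
  have := @integral_green_1d R l.1 (fun t => u (t, y))
    (fun t => 'D_(e1 R) u (t, y)) (fun t => 'D_(e1 R) (fun z =>
      'D_(e1 R) u z) (t, y))
    (fun t => wave k phi (t, y))
    (fun t => - omega1 k * sin (omega1 k * t + (omega2 k * y + phi)))
    (fun t => - omega1 k ^+ 2 * wave k phi (t, y)).
  apply; first exact: l1_gt0.
  - by move=> x; apply: slice1_is_derive.
  - by move=> x; apply: slice1_is_derive.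
  - by move=> x; under eq_fun do rewrite E; exact: cos_affine_is_derive.
  - by move=> x; rewrite E; exact: sin_affine_is_derive.
  - exact: (@slice1_continuous R _ y cu11').
  - by apply: (@slice1_continuous _ (fun x => - omega1 k ^+ 2 * wave k phi x))
    => x; apply: cvgM; [exact: cvg_cst|exact: cw].
  - exact: torus_function_slice1.
  - exact: (torus_function_slice1 y (@torus_function_derive _ _ _ (e1 R) pu)).
  - exact: (torus_function_slice1 y (wave_torus_function k phi)).
  (* The derivative of a wave is, up to a factor, the wave with its phase moved by a quarter period,
     so its periodicity is again that of waves. *)
  - congr (_ * _); rewrite -!cosBpihalf.
    have := torus_function_slice1 y (wave_torus_function k (phi - pi / 2)).
    by rewrite /wave /phase/= !addrA.
rewrite fubini_slices2_eq0//; last first.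
  move=> x; have E t : wave k phi (x, t) = cos (omega2 k * t + (omega1 k * x +
    phi)).
    by rewrite /wave /phase/=; congr cos; ring.
  have := @integral_green_1d R l.2 (fun t => u (x, t))
    (fun t => 'D_(e2 R) u (x, t)) (fun t => 'D_(e2 R) (fun z =>
      'D_(e2 R) u z) (x, t))
    (fun t => wave k phi (x, t))
    (fun t => - omega2 k * sin (omega2 k * t + (omega1 k * x + phi)))
    (fun t => - omega2 k ^+ 2 * wave k phi (x, t)).
  apply; first exact: l2_gt0.
  - by move=> y; apply: slice2_is_derive.
  - by move=> y; apply: slice2_is_derive.
  - by move=> y; under eq_fun do rewrite E; exact: cos_affine_is_derive.
  - by move=> y; rewrite E; exact: sin_affine_is_derive.
  - exact: (@slice2_continuous R _ x cu22').
  - by apply: (@slice2_continuous _ (fun x => - omega2 k ^+ 2 * wave k phi x))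
    => y; apply: cvgM; [exact: cvg_cst|exact: cw].
  - exact: torus_function_slice2.
  - exact: (torus_function_slice2 x (@torus_function_derive _ _ _ (e2 R) pu)).
  - exact: (torus_function_slice2 x (wave_torus_function k phi)).
  - congr (_ * _); rewrite -!cosBpihalf.
    have := torus_function_slice2 x (wave_torus_function k (phi - pi / 2)).
    rewrite /wave /phase/= => H.
    have H' y : omega2 k * y + (omega1 k * x + phi) - pi / 2
      = omega1 k * x + omega2 k * y + (phi - pi / 2) by ring.
    by rewrite !H'.
by rewrite addr0.
Qed.

Lemma eigenfunction_wave_orthogonal (u : R * R -> R) (m : R) k phi :
  torus_function l u -> C2_plane u ->
  (forall x, - laplacian_plane u x = m * u x) -> m != omegasq k ->
  \int[mu]_(x in D) (u x * wave k phi x) = 0.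
Proof.
move=> pu Cu ulam neq; have := wave_green k phi pu Cu.
have cu : continuous u by case: Cu => -[].
have -> : \int[mu]_(x in D)
    (laplacian_plane u x * wave k phi x + omegasq k * u x * wave k phi x) =
    \int[mu]_(x in D) ((omegasq k - m) * (u x * wave k phi x)).
  apply: eq_Rintegral => x _; rewrite -[laplacian_plane _ _]opprK ulam.
  by move: (omegasq k) (wave k phi x) (u x) => a b c; ring.
rewrite RintegralZl//; last 2 first.
- exact: measurable_fundamental_domain.
- apply: continuous_torus_integrable => // x.
  by apply: cvgM; [exact: cu|exact: wave_continuous].
move=> /eqP; rewrite mulf_eq0 => /orP[|/eqP//].
by rewrite subr_eq0 eq_sym (negPf neq).
Qed.

Lemma omegasq_eq0 k : (omegasq k == 0) = (k == 0).
Proof.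
rewrite /omegasq paddr_eq0 ?sqr_ge0// !expf_eq0/= /omega1 /omega2.
rewrite !mulf_eq0 !invr_eq0 !intr_eq0 pnatr_eq0/= !(gt_eqF (pi_gt0 R)).
by rewrite !(gt_eqF l1_gt0) !(gt_eqF l2_gt0) !orbF; case: k.
Qed.

Lemma C2_plane_cst (c : R) : C2_plane (fun=> c).
Proof.
have C1 (b : R) : C1_plane (fun=> b).
  split=> [x|v _]; first exact: cvg_cst.
  split=> x; first exact: derivable_cst.
  by under eq_fun do rewrite derive_cst; exact: cvg_cst.
split=> // v _; have -> // : (fun x : R * R => 'D_v (fun=> c) x) = fun=> 0.
by apply/funext => x; rewrite derive_cst.
Qed.

(** The constant 1 is an eigenfunction of eigenvalue 0, so orthogonality for distinct eigenvalues
    replaces a computation of the integral. *)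
Lemma integral_wave_eq0 k phi : k != 0 -> \int[mu]_(x in D) wave k phi x = 0.
Proof.
move=> k0; have := @eigenfunction_wave_orthogonal (fun=> 1) 0 k phi.
under eq_Rintegral do rewrite mul1r; apply=> //.
- exact: C2_plane_cst.
- move=> x; rewrite mul0r /laplacian_plane.
  have E v : (fun y => 'D_v (fun=> 1 : R) y) = (fun=> 0).
    by apply/funext => y; rewrite derive_cst.
  by rewrite !E !derive_cst addr0 oppr0.
- by rewrite eq_sym omegasq_eq0.
Qed.

End Waves.

(** * Uniqueness of Fourier coefficients *)

Section Uniqueness.
Variables (R : realType) (l : R * R).
Hypotheses (l1_gt0 : 0 < l.1) (l2_gt0 : 0 < l.2).
Local Notation mR := (measurableTypeR R).
Local Notation leb := (@lebesgue_measure R).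
Local Notation mu := (leb \x leb)%E.
Local Notation D := (fundamental_domain l).
Local Notation J := (int * int)%type.

(** Real trigonometric polynomials, as a predicate on functions instead of a list of coefficients:
    closure under products and orthogonality are then plain inductions. *)
Inductive trig_poly : (R * R -> R) -> Prop :=
| trig_wave k phi : trig_poly (wave l k phi)
| trig_add p q : trig_poly p -> trig_poly q -> trig_poly (fun x => p x + q x)
| trig_scale c p : trig_poly p -> trig_poly (fun x => c * p x).

Lemma phaseD k m x : phase l (k + m) x = phase l k x + phase l m x.
Proof.
rewrite /phase /omega1 /omega2 /= !intrD.
by rewrite !(mulrDr (2 * pi)) !mulrDl; rewrite addrACA.
Qed.

Lemma phaseB k m x : phase l (k - m) x = phase l k x - phase l m x.
Proof. by apply/eqP; rewrite eq_sym subr_eq -phaseD subrK. Qed.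

Lemma waveM k m phi psi x : wave l k phi x * wave l m psi x =
  2^-1 * wave l (k + m) (phi + psi) x + 2^-1 * wave l (k - m) (phi - psi) x.
Proof.
rewrite /wave phaseD phaseB.
move: (phase l k x) (phase l m x) => s t.
have -> : s + t + (phi + psi) = (s + phi) + (t + psi) by ring.
have -> : s - t + (phi - psi) = (s + phi) - (t + psi) by ring.
by move: (s + phi) (t + psi) => A B; rewrite cosD cosB; field.
Qed.

Lemma trig_mul p q : trig_poly p -> trig_poly q ->
  trig_poly (fun x => p x * q x).
Proof.
move=> tp tq; elim: tp => {p} [k phi|p1 p2 _ IH1 _ IH2|c p _ IH].
- elim: tq => {q} [m psi|p1 p2 _ IH1 _ IH2|c p _ IH].
  + under eq_fun do rewrite waveM.
    by apply: trig_add; apply: trig_scale; apply: trig_wave.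
  + by under eq_fun do rewrite mulrDr; exact: trig_add.
  + by under eq_fun do rewrite mulrCA; exact: trig_scale.
- by under eq_fun do rewrite mulrDl; exact: trig_add.
- by under eq_fun do rewrite -mulrA; exact: trig_scale.
Qed.

Lemma trig_cst c : trig_poly (fun=> c).
Proof.
have -> : (fun=> c) = (fun x => c * wave l 0 0 x).
  apply/funext => x; rewrite /wave /phase /omega1 /omega2.
  by rewrite !(mulr0, mul0r, addr0) cos0 mulr1.
exact/trig_scale/trig_wave.
Qed.

Lemma trig_exp p n : trig_poly p -> trig_poly (fun x => p x ^+ n).
Proof.
move=> tp; elim: n => [|n IH]; first exact: trig_cst.
by under eq_fun do rewrite exprS; exact: trig_mul.
Qed.

Lemma trig_continuous p : trig_poly p -> continuous p.
Proof.
elim=> {p} [k phi|p q _ cp _ cq|c p _ cp] x.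
- exact: wave_continuous.
- by apply: cvgD; [exact: cp|exact: cq].
- by apply: cvgM; [exact: cvg_cst|exact: cp].
Qed.

Lemma trig_orthogonal (f p : R * R -> R) : continuous f ->
  (forall k phi, \int[mu]_(x in D) (f x * wave l k phi x) = 0) ->
  trig_poly p -> \int[mu]_(x in D) (f x * p x) = 0.
Proof.
move=> cf f0; have mD := measurable_fundamental_domain l.
have ifp q : trig_poly q -> mu.-integrable D (EFin \o (fun x => f x * q x)).
  move=> tq; apply: continuous_torus_integrable => // x.
  by apply: cvgM; [exact: cf|exact: trig_continuous].
elim=> {p} [k phi|p q tp p0 tq q0|c p tp p0]; first exact: f0.
- under eq_Rintegral do rewrite mulrDr.
  by rewrite RintegralD ?p0 ?q0 ?addr0//; exact: ifp.
- under eq_Rintegral do rewrite mulrCA.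
  by rewrite RintegralZl// ?p0 ?mulr0//; exact: ifp.
Qed.

(** By the double angle formula the sine of pi |t| / L vanishes, and sine is positive strictly
    between 0 and pi. The case |t| = L does occur: opposite sides of the closed rectangle are a full
    period apart. *)
Lemma cos_eq1 (L t : R) : 0 < L -> `|t| <= L -> cos (2 * pi / L * t) = 1 ->
  t = 0 \/ `|t| = L.
Proof.
move=> L0 tL; rewrite -cos_norm normrM gtr0_norm ?divr_gt0 ?mulr_gt0 ?pi_gt0//.
have -> : 2 * pi / L * `|t| = (pi / L * `|t|) *+ 2 by rewrite -mulr_natl; ring.
rewrite cos_mulr2n cos2sin2 => E.
have {E} /eqP : sin (pi / L * `|t|) ^+ 2 = 0 by lra.
rewrite expf_eq0/= => /eqP s0.
have [->|t0] := eqVneq t 0; first by left.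
right; apply/eqP; rewrite eq_le tL leNgt; apply/negP => tL'.
suff : 0 < sin (pi / L * `|t|) by rewrite s0 ltxx.
apply: sin_gt0_pi; rewrite mulr_gt0 ?divr_gt0 ?pi_gt0 ?normr_gt0//=.
by rewrite mulrAC ltr_pdivrMr// ltr_pM2l ?pi_gt0.
Qed.

(** Two cosines, one per coordinate, both maximal at [p]. The weights 1/2 and 1/4 bring the range
    into [0, 1], with the value 1 exactly at the points congruent to [p] modulo the lattice. *)
Definition peak (p x : R * R) : R :=
  2^-1 + 4^-1 * (wave l (1, 0) (- (2 * pi / l.1 * p.1)) x
                 + wave l (0, 1) (- (2 * pi / l.2 * p.2)) x).

Lemma peakE p x : peak p x = 2^-1 + 4^-1 * (cos (2 * pi / l.1 * (x.1 - p.1))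
  + cos (2 * pi / l.2 * (x.2 - p.2))).
Proof.
rewrite /peak /wave /phase /omega1 /omega2/= !mulr1 !(mulr0, mul0r) addr0 add0r.
by rewrite -!mulrBr.
Qed.

Lemma trig_peak p : trig_poly (peak p).
Proof.
by apply: trig_add; [exact: trig_cst|apply/trig_scale/trig_add;
  exact: trig_wave].
Qed.

Lemma peak_ge0 p x : 0 <= peak p x.
Proof.
rewrite peakE; have := cos_geN1 (2 * pi / l.1 * (x.1 - p.1)).
have := cos_geN1 (2 * pi / l.2 * (x.2 - p.2)); lra.
Qed.

Lemma peak_le1 p x : peak p x <= 1.
Proof.
rewrite peakE; have := cos_le1 (2 * pi / l.1 * (x.1 - p.1)).
have := cos_le1 (2 * pi / l.2 * (x.2 - p.2)); lra.
Qed.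

(** At the value 1 both cosines are 1, so each coordinate of [x - p] is 0 or a full period up to
    sign. Concluding on values of [f] avoids a separate notion of congruence. *)
Lemma peak_eq1 (f : R * R -> R) p x : torus_function l f ->
  D p -> (`[0, l.1] `*` `[0, l.2]) x -> peak p x = 1 -> f x = f p.
Proof.
move=> pf [/=]; rewrite !in_itv/= => /andP[p1 pl1] /andP[p2 pl2].
move=> [/=]; rewrite ?in_itv/= => /andP[x1 xl1] /andP[x2 xl2].
rewrite peakE => E.
have C1 := cos_le1 (2 * pi / l.1 * (x.1 - p.1)).
have C2 := cos_le1 (2 * pi / l.2 * (x.2 - p.2)).
have per1 z : f (z.1 + l.1, z.2) = f z.
  rewrite -[RHS](pf _ _ (lattice_e1 l)); congr f.
  by rewrite -[in LHS](addr0 z.2).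
have per2 z : f (z.1, z.2 + l.2) = f z.
  rewrite -[RHS](pf _ _ (lattice_e2 l)); congr f.
  by rewrite -[in LHS](addr0 z.1).
have shift1 y : f (x.1, y) = f (p.1, y).
  have [] : x.1 - p.1 = 0 \/ `|x.1 - p.1| = l.1.
  - by apply: cos_eq1 => //; [rewrite ler_norml; apply/andP; split; lra|lra].
  - by move/subr0_eq ->.
  - case: (ger0P (x.1 - p.1)) => _ H.
    + by rewrite -(per1 (p.1, y)) /= -H; congr (f (_, _)); ring.
    + by rewrite -(per1 (x.1, y)) /= -H; congr (f (_, _)); ring.
have shift2 y : f (y, x.2) = f (y, p.2).
  have [] : x.2 - p.2 = 0 \/ `|x.2 - p.2| = l.2.
  - by apply: cos_eq1 => //; [rewrite ler_norml; apply/andP; split; lra|lra].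
  - by move/subr0_eq ->.
  - case: (ger0P (x.2 - p.2)) => _ H.
    + by rewrite -(per2 (y, p.2)) /= -H; congr (f (_, _)); ring.
    + by rewrite -(per2 (y, x.2)) /= -H; congr (f (_, _)); ring.
by case: x p {p1 pl1 p2 pl2 x1 xl1 x2 xl2 E C1 C2} shift1 shift2 =>
  [u v] [u' v']/= -> ->.
Qed.

(** Compactness makes the bound uniform: [peak p] attains its maximum on the part of the closed
    rectangle where [f <= c], and the value 1 there would force [f] to equal [f p], which exceeds
    [c]. *)
Lemma peak_away (f : R * R -> R) p c : torus_function l f -> continuous f ->
  D p -> c < f p ->
  exists2 r, 0 <= r < 1 & forall x, D x -> f x <= c -> peak p x <= r.
Proof.
move=> pf cf Dp cfp; pose K0 : set (R * R) := `[0, l.1] `*` `[0, l.2].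
have DK0 x : D x -> K0 x.
  move=> [/=]; rewrite !in_itv/= => /andP[? ?] /andP[? ?].
  by split; rewrite /= in_itv/=; apply/andP; split => //; exact: ltW.
have cK0 : compact K0 by apply: compact_setX; exact: segment_compact.
pose K := K0 `&` [set x | f x <= c].
have cK : compact K.
  apply: compact_closedI => //.
  apply: (@closed_comp _ _ f [set y | y <= c]) => [x _|];
    [exact: cf|exact: closed_le].
have [K_0|/set0P K_0] := eqVneq K set0.
  exists 0; first by rewrite lexx ltr01.
  move=> x Dx fxc; exfalso; suff : K x by rewrite K_0.
  by split => //; exact: DK0.
have cp : continuous (peak p) by exact: trig_continuous (trig_peak p).
have [y /set_mem[K0y fy] ymax] := compact_EVT_max K_0 cK (continuous_subspaceT
  cp).
exists (peak p y); last first.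
  by move=> x Dx fxc; apply: ymax; apply/mem_set; split => //; exact: DK0.
rewrite peak_ge0/= lt_neqAle peak_le1 andbT; apply/eqP =>
  /(peak_eq1 pf Dp K0y) E.
by move: fy; rewrite /= E leNgt cfp.
Qed.

Lemma floor_reduce (L t : R) : 0 < L ->
  0 <= t + L * (- Num.floor (t / L))%:~R < L.
Proof.
move=> L0; have := floor_itv (t / L).
rewrite ler_pdivlMr// ltr_pdivrMr// intrD mulrDl mul1r mulrNz mulrN mulrC.
by move=> /andP[? ?]; apply/andP; split; lra.
Qed.

Lemma torus_function_reduce (T : Type) (f : R * R -> T) x :
  torus_function l f ->
  exists2 p, D p & f p = f x.
Proof.
move=> pf; pose m := Num.floor (x.1 / l.1); pose n := Num.floor (x.2 / l.2).
pose g : R * R := (l.1 * (- m)%:~R, l.2 * (- n)%:~R).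
exists (x + g); last by apply: pf; exists (- m), (- n).
by split; rewrite /= in_itv/=; exact: floor_reduce.
Qed.

(** Where [f <= c] the product loses at most [M * r1 ^+ n]. On the small square [Q] at [p] the peak
    exceeds [r2], hence [r1], which forces [f > c] there and a gain of [c * r2 ^+ n]. As [r1 < r2],
    the gain wins for large [n]. *)
Lemma peak_lower_bound (f : R * R -> R) p c : torus_function l f ->
  continuous f -> D p -> 0 < c < f p ->
  exists Q M r1 r2, [/\ measurable (Q : set (mR * mR)), Q `<=` D, (0 < mu Q)%E,
    0 <= r1 < r2 & forall n x, D x ->
      c * r2 ^+ n * \1_Q x - M * r1 ^+ n <= f x * peak p x ^+ n].
Proof.
move=> pf cf Dp /andP[c0 cfp].
have [r /andP[r0 r1] hr] := peak_away pf cf Dp cfp.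
have [M M0 fM] := continuous_plane_bounded l cf.
pose r2 := (r + 1) / 2.
have rr2 : r < r2 by rewrite /r2; lra.
have : \forall x \near p, r2 < peak p x.
  have cp : continuous (peak p) by exact: trig_continuous (trig_peak p).
  apply: (cvgr_gt _ (cp p)).
  by rewrite peakE !subrr !mulr0 cos0 /r2; lra.
move=> /nbhs_ballP[e /= e0 he].
have [p1 pl1 p2 pl2] : [/\ 0 <= p.1, p.1 < l.1, 0 <= p.2 & p.2 < l.2].
  by move: Dp => [/=]; rewrite !in_itv/= => /andP[? ?] /andP[? ?].
(* [Q] has [p] as its lower left corner: [p] may lie on the closed sides of [D], so a square centred
   at [p] could leave [D]. *)
pose d := Num.min e (Num.min (l.1 - p.1) (l.2 - p.2)).
have d0 : 0 < d by rewrite /d !lt_min e0 !subr_gt0 pl1.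
have de : d <= e by rewrite /d ge_min lexx.
have d1 : d <= l.1 - p.1 by rewrite /d !ge_min lexx orbT.
have d2 : d <= l.2 - p.2 by rewrite /d !ge_min lexx !orbT.
pose Q : set (mR * mR) := `[p.1, p.1 + d[ `*` `[p.2, p.2 + d[.
have QE x : Q x -> [/\ p.1 <= x.1, x.1 < p.1 + d, p.2 <= x.2 & x.2 < p.2 + d].
  by move=> [/=]; rewrite !in_itv/= => /andP[? ?] /andP[? ?].
have QD : Q `<=` D.
  by move=> x /QE[? ? ? ?]; split; rewrite /= in_itv/=; apply/andP; split; lra.
exists Q, M, r, r2; split => //.
- by apply: measurableX; exact: measurable_itv.
- rewrite product_measure1E //= !lebesgue_measure_itv/= !lte_fin !ltrDl d0.
  by rewrite -!EFinD -EFinM lte_fin !(addrC _ d) !addrK mulr_gt0.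
- by rewrite r0.
move=> n x Dx; have pn0 : 0 <= peak p x ^+ n by rewrite exprn_ge0// peak_ge0.
have [fxc|cfx] := lerP (f x) c.
  have px := hr x Dx fxc.
  have xQ : \1_Q x = 0 :> R.
    rewrite indicE memNset// => /QE[? ? ? ?].
    suff : r2 < peak p x by rewrite ltNge (le_trans px (ltW rr2)).
    by apply: he; split; rewrite /ball/= ltr_distlC; apply/andP; split; lra.
  have fx : - M <= f x by move: (fM _ Dx); rewrite ler_norml => /andP[].
  have pr : peak p x ^+ n <= r ^+ n by rewrite lerXn2r ?nnegrE ?peak_ge0.
  rewrite xQ mulr0 sub0r -mulNr; nra.
have xM : 0 <= M * r ^+ n by rewrite mulr_ge0 ?exprn_ge0// ltW.
rewrite lerBlDr; apply: ler_wpDr => //.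
rewrite indicE; case: (boolP (x \in Q)) => xQ /=; last first.
  by rewrite mulr0 mulr_ge0// ltW// (lt_trans c0).
have r20 : 0 <= r2 by rewrite (le_trans r0)// ltW.
rewrite mulr1 ler_pM ?exprn_ge0//; [exact: ltW|exact: ltW|].
rewrite lerXn2r ?nnegrE ?peak_ge0//; apply: ltW.
move: xQ => /set_mem/QE[? ? ? ?].
by apply: he; split; rewrite /ball/= ltr_distlC; apply/andP; split; lra.
Qed.

(* The powers of [peak p] concentrate near [p] modulo the lattice, so pairing
   them with a function that is positive at [p] cannot give zero. *)
Lemma fourier_uniqueness (f : R * R -> R) : torus_function l f ->
  continuous f ->
  (forall k phi, \int[mu]_(x in D) (f x * wave l k phi x) = 0) ->
  forall x, f x = 0.
Proof.
have mD := measurable_fundamental_domain l.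
(* It is enough to exclude positive values, because the hypotheses are stable under negation. *)
suff H (g : R * R -> R) : torus_function l g -> continuous g ->
    (forall k phi, \int[mu]_(x in D) (g x * wave l k phi x) = 0) ->
    forall x, g x <= 0.
  move=> pf cf f0 x; apply/eqP; rewrite eq_le H//= -oppr_le0.
  apply: (H (fun x => - f x)) => [z h lh|z|k phi].
  - by rewrite pf.
  - by apply: cvgN; exact: cf.
  - under eq_Rintegral do rewrite mulNr -mulN1r.
    rewrite RintegralZl ?f0 ?mulr0//; apply: continuous_torus_integrable => //.
    by move=> z; apply: cvgM; [exact: cf|exact: wave_continuous].
move=> pg cg g0 x; have [p Dp <-] := torus_function_reduce x pg.
rewrite leNgt; apply/negP => gp0.
have [Q [M [r1 [r2 [mQ QD Q0 /andP[r10 r12] bnd]]]]] : exists Q M r1 r2,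
  [/\ measurable (Q : set (mR * mR)), Q `<=` D, (0 < mu Q)%E,
    0 <= r1 < r2 & forall n x, D x ->
      g p / 2 * r2 ^+ n * \1_Q x - M * r1 ^+ n <= g x * peak p x ^+ n].
  by apply: peak_lower_bound => //; apply/andP; split; lra.
have r20 : 0 < r2 by exact: le_lt_trans r12.
have muD : (mu D < +oo)%E.
  by rewrite fundamental_domain_measure// ltry.
have muQfin : mu Q \is a fin_num.
  rewrite ge0_fin_numE//; apply: le_lt_trans muD.
  by apply: le_measure => //; rewrite inE.
pose q := fine (mu Q).
have q0 : 0 < q by rewrite -lte_fin fineK.
have iind : mu.-integrable D (EFin \o (\1_Q : R * R -> R)).
  apply: (bounded_torus_integrable l1_gt0 l2_gt0 (M := 1)).
    exact: measurable_indic.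
  by move=> z _; rewrite indicE; case: (_ \in _); rewrite ?normr1 ?normr0.
have iQ n : mu.-integrable D (EFin \o (fun z => g p / 2 * r2 ^+ n * \1_Q z)).
  apply: (bounded_torus_integrable l1_gt0 l2_gt0 (M := g p / 2 * r2 ^+ n)).
    by apply: measurable_funM => //; exact: measurable_indic.
  have c0 : 0 <= g p / 2 * r2 ^+ n by rewrite mulr_ge0 ?exprn_ge0// ltW//
    divr_gt0.
  move=> z _; rewrite indicE; case: (_ \in _); rewrite ?mulr1 ?mulr0 ?normr0//.
  by rewrite ger0_norm.
have icst c : mu.-integrable D (EFin \o (fun=> c)).
  by apply: continuous_torus_integrable => // z; exact: cvg_cst.
(* The lower bound is integrated against an integral that vanishes and divided by [r2 ^+ n]: a fixed
   positive number stays below a geometric sequence tending to 0. *)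
have key n : g p / 2 * q <= M * (l.1 * l.2) * (r1 / r2) ^+ n.
  have : \int[mu]_(x in D) (g p / 2 * r2 ^+ n * \1_Q x - M * r1 ^+ n) <=
         \int[mu]_(x in D) (g x * peak p x ^+ n).
    apply: le_Rintegral => //.
    - exact: (integrableB mD (iQ n) (icst (M * r1 ^+ n))).
    - apply: continuous_torus_integrable => // z.
      apply: cvgM; first exact: cg.
      exact: (trig_continuous (trig_exp n (trig_peak p))).
    - exact: bnd.
  rewrite (trig_orthogonal cg g0 (trig_exp n (trig_peak p))).
  rewrite RintegralB// RintegralZl//.
  rewrite Rintegral_cst// /Rintegral.
  rewrite integral_indic// (setIidl QD) -/q subr_le0 => H.
  have r2n : 0 < r2 ^+ n by rewrite exprn_gt0.
  rewrite expr_div_n mulrA ler_pdivlMr//.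
  have aD : fine (mu D) = l.1 * l.2 := torus_areaE l1_gt0 l2_gt0.
  move: H; rewrite -/q aD => H; lra.
have : (fun n => M * (l.1 * l.2) * (r1 / r2) ^+ n) @ \oo --> (0 : R).
  rewrite -[X in _ --> X](mulr0 (M * (l.1 * l.2))); apply: cvgM;
    first exact: cvg_cst.
  apply: cvg_expr; rewrite ger0_norm ?ltr_pdivrMr ?mul1r//.
  by rewrite divr_ge0// ltW.
move=> cv; have [|n _ /(_ n (leqnn n))] := cvgr_lt _ cv (g p / 2 * q).
  by rewrite mulr_gt0 ?divr_gt0.
by rewrite /= ltNge key.
Qed.

End Uniqueness.

(** * Complex square integrable functions *)

Section ComplexParts.
Variable R : realType.
Implicit Types z w : R[i].
Local Notation cj := Num.conj.
Local Notation ReC := complex.Re.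
Local Notation ImC := complex.Im.

Lemma complex_eqP z w : ReC z = ReC w -> ImC z = ImC w -> z = w.
Proof. by case: z w => [a b] [c d] /= -> ->. Qed.

Lemma ReD z w : ReC (z + w) = ReC z + ReC w.
Proof. by case: z w => [? ?] []. Qed.
Lemma ImD z w : ImC (z + w) = ImC z + ImC w.
Proof. by case: z w => [? ?] []. Qed.
Lemma ReN z : ReC (- z) = - ReC z. Proof. by case: z. Qed.
Lemma ImN z : ImC (- z) = - ImC z. Proof. by case: z. Qed.
Lemma ReM z w : ReC (z * w) = ReC z * ReC w - ImC z * ImC w.
Proof. by case: z w => [? ?] []. Qed.
Lemma ImM z w : ImC (z * w) = ReC z * ImC w + ImC z * ReC w.
Proof. by case: z w => [? ?] []. Qed.
Lemma ReJ z : ReC (cj z) = ReC z. Proof. by case: z. Qed.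
Lemma ImJ z : ImC (cj z) = - ImC z. Proof. by case: z. Qed.

Lemma conjM z w : cj (z * w) = cj z * cj w. Proof. exact: rmorphM. Qed.
Lemma conjB z w : cj (z - w) = cj z - cj w. Proof. exact: rmorphB. Qed.
Lemma conj_sum (I : Type) (s : seq I) (F : I -> R[i]) :
  cj (\sum_(i <- s) F i) = \sum_(i <- s) cj (F i).
Proof. exact: rmorph_sum. Qed.

Lemma normc_sqr z : normc z ^+ 2 = ReC z ^+ 2 + ImC z ^+ 2.
Proof. by case: z => a b /=; rewrite sqr_sqrtr// addr_ge0 ?sqr_ge0. Qed.

Lemma normc_sqrJ z : normc (cj z) ^+ 2 = normc z ^+ 2.
Proof. by rewrite !normc_sqr ReJ ImJ sqrrN. Qed.

Lemma normc_sqr0 : normc (0 : R[i]) ^+ 2 = 0.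
Proof. by rewrite normc0 expr0n. Qed.

Lemma normc_sqrM z w : normc (z * w) ^+ 2 = normc z ^+ 2 * normc w ^+ 2.
Proof. by rewrite normcM exprMn. Qed.

Lemma mulcJ z : z * cj z = (normc z ^+ 2)%:C.
Proof.
apply: complex_eqP; rewrite ?ReM ?ImM !ReJ !ImJ ?normc_sqr /=; first by ring.
by rewrite [X in _ + X]mulrC mulrN addNr.
Qed.

Lemma normc_sqrD_le z w :
  normc (z + w) ^+ 2 <= 2 * (normc z ^+ 2 + normc w ^+ 2).
Proof.
rewrite !normc_sqr !ReD !ImD.
have := sqr_ge0 (ReC z - ReC w); have := sqr_ge0 (ImC z - ImC w).
rewrite !sqrrB !sqrrD; lra.
Qed.

End ComplexParts.

Section TorusL2.
Variables (R : realType) (l : R * R).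
Local Notation mR := (measurableTypeR R).
Local Notation leb := (@lebesgue_measure R).
Local Notation mu := (leb \x leb)%E.
Local Notation D := (fundamental_domain l).
Local Notation cj := Num.conj.
Local Notation ReC := complex.Re.
Local Notation ImC := complex.Im.
Implicit Types f g h : R * R -> R[i].
Local Notation mD := (measurable_fundamental_domain l).

Definition torus_measurable f :=
  measurable_fun [set: mR * mR] (fun x => ReC (f x)) /\
  measurable_fun [set: mR * mR] (fun x => ImC (f x)).

Definition torus_integrable f :=
  mu.-integrable D (EFin \o (fun x => ReC (f x))) /\
  mu.-integrable D (EFin \o (fun x => ImC (f x))).

(** [torus_L2] without lattice invariance, and with finiteness of the norm recast as integrability,
    the form that linearity of the integral consumes. *)
Definition square_integrable f :=
  torus_measurable f /\ mu.-integrable D (EFin \o (fun x => normc (f x) ^+ 2)).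

Definition normsq f : R := \int[mu]_(x in D) (normc (f x) ^+ 2).

Lemma torus_measurableD f g : torus_measurable f -> torus_measurable g ->
  torus_measurable (fun x => f x + g x).
Proof.
move=> [? ?] [? ?]; split.
  by under eq_fun do rewrite ReD; exact: measurable_funD.
by under eq_fun do rewrite ImD; exact: measurable_funD.
Qed.

Lemma torus_measurableM f g : torus_measurable f -> torus_measurable g ->
  torus_measurable (fun x => f x * g x).
Proof.
move=> [? ?] [? ?]; split.
  under eq_fun do rewrite ReM.
  by apply: measurable_funB; exact: measurable_funM.
under eq_fun do rewrite ImM.
by apply: measurable_funD; exact: measurable_funM.
Qed.

Lemma torus_measurableJ f : torus_measurable f ->
  torus_measurable (fun x => cj (f x)).
Proof.
move=> [? ?]; split; first by under eq_fun do rewrite ReJ.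
by under eq_fun do rewrite ImJ; exact: measurableT_comp.
Qed.

Lemma torus_measurable_cst c : torus_measurable (fun=> c).
Proof. by split; exact: measurable_cst. Qed.

Lemma torus_measurable_normc f : torus_measurable f ->
  measurable_fun [set: mR * mR] (fun x => normc (f x) ^+ 2).
Proof.
move=> [mr mi]; under eq_fun do rewrite normc_sqr.
by apply: measurable_funD; exact: measurable_funX.
Qed.

Lemma dominated_integrable (u v : R * R -> R) :
  measurable_fun [set: mR * mR] u -> mu.-integrable D (EFin \o v) ->
  (forall x, `|u x| <= v x) -> mu.-integrable D (EFin \o u).
Proof.
move=> mu_ iv uv; apply: le_integrable iv => //; first exact: mD.
  by apply/measurable_EFinP; apply: measurable_funTS.
by move=> x _ /=; rewrite lee_fin (le_trans (uv x))// ler_norm.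
Qed.

Lemma torus_L2_square_integrable f : torus_L2 l f -> square_integrable f.
Proof.
move=> [_ mr mi fin]; split=> //; apply/integrableP; split.
  apply/measurable_EFinP; apply: measurable_funTS.
  exact: torus_measurable_normc.
apply: le_lt_trans fin; rewrite le_eqVlt; apply/orP; left; apply/eqP.
by apply: eq_integral => x _ /=; rewrite ger0_norm// sqr_ge0.
Qed.

Lemma torus_normsqE f : square_integrable f ->
  torus_normsq l f = (normsq f)%:E.
Proof.
move=> [_ fi]; rewrite /normsq /Rintegral fineK//.
by apply: (integrable_fin_num mD fi).
Qed.

Lemma square_integrableD f g : square_integrable f -> square_integrable g ->
  square_integrable (fun x => f x + g x).
Proof.
move=> [mf fi] [mg gi]; have mfg := torus_measurableD mf mg; split=> //.
have := integrableZl mD 2 (integrableD mD fi gi).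
move=> H; apply: (dominated_integrable _ H); first exact:
  torus_measurable_normc.
by move=> x; rewrite ger0_norm ?sqr_ge0//; exact: normc_sqrD_le.
Qed.

Lemma square_integrable_bounded f g M : torus_measurable g ->
  (forall x, normc (g x) ^+ 2 <= M) ->
  square_integrable f -> square_integrable (fun x => f x * g x).
Proof.
move=> mg gM [mf fi]; have mfg := torus_measurableM mf mg; split=> //.
have H := integrableZl mD M fi.
apply: (dominated_integrable _ H); first exact: torus_measurable_normc.
move=> x; rewrite ger0_norm ?sqr_ge0// normc_sqrM mulrC.
by rewrite ler_wpM2r ?sqr_ge0.
Qed.

Lemma square_integrableZ c f : square_integrable f ->
  square_integrable (fun x => c * f x).
Proof.
move=> fi; under eq_fun do rewrite mulrC.
exact: (square_integrable_bounded (torus_measurable_cst c) (fun=> lexx _)).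
Qed.

Lemma square_integrable0 : square_integrable (fun=> 0).
Proof.
split; first exact: torus_measurable_cst.
by under eq_fun do rewrite normc_sqr0; exact: integrable0.
Qed.

Lemma square_integrable_sum (I : Type) (s : seq I) (F : I -> R * R -> R[i]) :
  (forall i, square_integrable (F i)) ->
  square_integrable (fun x => \sum_(i <- s) F i x).
Proof.
move=> Fi; elim: s => [|i s IH].
  by under eq_fun do rewrite big_nil; exact: square_integrable0.
by under eq_fun do rewrite big_cons; exact: square_integrableD.
Qed.

(** Both parts of the product are dominated by |f|^2 + |g|^2; the squares of sums and differences of
    the coordinates certify this. *)
Lemma square_integrable_prod f g : square_integrable f -> square_integrable g ->
  torus_integrable (fun x => f x * cj (g x)).
Proof.
move=> [mf fi] [mg gi].
have [mr mi] := torus_measurableM mf (torus_measurableJ mg).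
have H := integrableD mD fi gi.
split; apply: (dominated_integrable _ H) => // x.
  rewrite !normc_sqr ReM ReJ ImJ; move: (ReC (f x)) (ReC (g x)) (ImC (f x)) (ImC
    (g x)) => a b c d.
  have := sqr_ge0 (a - b); have := sqr_ge0 (a + b).
  have := sqr_ge0 (c - d); have := sqr_ge0 (c + d).
  by rewrite ler_norml => ? ? ? ?; apply/andP; split; lra.
rewrite !normc_sqr ImM ReJ ImJ; move: (ReC (f x)) (ReC (g x)) (ImC (f x)) (ImC
  (g x)) => a b c d.
have := sqr_ge0 (a - d); have := sqr_ge0 (a + d).
have := sqr_ge0 (c - b); have := sqr_ge0 (c + b).
by rewrite ler_norml => ? ? ? ?; apply/andP; split; lra.
Qed.

Lemma torus_integralD f g : torus_integrable f -> torus_integrable g ->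
  torus_integral l (fun x => f x + g x) =
  torus_integral l f + torus_integral l g.
Proof.
move=> [fr fi] [gr gi]; apply: complex_eqP; rewrite ?ReD ?ImD /=.
  by under eq_Rintegral do rewrite ReD; rewrite RintegralD//; exact: mD.
by under eq_Rintegral do rewrite ImD; rewrite RintegralD//; exact: mD.
Qed.

Lemma torus_integralZ c f : torus_integrable f ->
  torus_integral l (fun x => c * f x) = c * torus_integral l f.
Proof.
move=> [fr fi]; apply: complex_eqP; rewrite ?ReM ?ImM /=.
  under eq_Rintegral do rewrite ReM.
  rewrite RintegralB ?RintegralZl//; try exact: mD.
    exact: (integrableZl mD _ fr).
  exact: (integrableZl mD _ fi).
under eq_Rintegral do rewrite ImM.
rewrite RintegralD ?RintegralZl//; try exact: mD.
  exact: (integrableZl mD _ fi).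
exact: (integrableZl mD _ fr).
Qed.

Lemma torus_innerD f g h : square_integrable f -> square_integrable g ->
  square_integrable h ->
  torus_inner l (fun x => f x + g x) h = torus_inner l f h + torus_inner l g h.
Proof.
move=> fi gi hi; rewrite /torus_inner.
under eq_fun do rewrite mulrDl.
by rewrite torus_integralD//; exact: square_integrable_prod.
Qed.

Lemma torus_innerZ c f h : square_integrable f -> square_integrable h ->
  torus_inner l (fun x => c * f x) h = c * torus_inner l f h.
Proof.
move=> fi hi; rewrite /torus_inner.
under eq_fun do rewrite -mulrA.
by rewrite torus_integralZ//; exact: square_integrable_prod.
Qed.

Lemma torus_innerJ f g : square_integrable f -> square_integrable g ->
  torus_inner l g f = cj (torus_inner l f g).
Proof.
move=> fi gi; have [ir ii] := square_integrable_prod fi gi.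
rewrite /torus_inner; apply: complex_eqP; rewrite ?ReJ ?ImJ /=.
  by apply: eq_Rintegral => x _; rewrite !ReM !ReJ !ImJ; ring.
rewrite -mulN1r -RintegralZl//; last exact: mD.
by apply: eq_Rintegral => x _; rewrite !ImM !ReJ !ImJ; ring.
Qed.

Lemma torus_inner0 h : torus_inner l (fun=> 0) h = 0.
Proof.
rewrite /torus_inner /torus_integral.
under eq_Rintegral do rewrite mul0r.
under [X in _ +i* X]eq_Rintegral do rewrite mul0r.
by rewrite /= !Rintegral_cst ?mul0r//; exact: mD.
Qed.

Lemma torus_inner_sum (I : Type) (s : seq I) (c : I -> R[i])
    (F : I -> R * R -> R[i]) h :
  (forall i, square_integrable (F i)) -> square_integrable h ->
  torus_inner l (fun x => \sum_(i <- s) c i * F i x) h =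
  \sum_(i <- s) c i * torus_inner l (F i) h.
Proof.
move=> Fi hi; elim: s => [|i s IH].
  by under eq_fun do rewrite big_nil; rewrite torus_inner0 big_nil.
under eq_fun do rewrite big_cons.
rewrite torus_innerD ?torus_innerZ// ?big_cons ?IH//.
  exact: square_integrableZ.
by apply: square_integrable_sum => j; exact: square_integrableZ.
Qed.

Lemma torus_inner_sumr (I : Type) (s : seq I) (c : I -> R[i])
    (F : I -> R * R -> R[i]) h :
  (forall i, square_integrable (F i)) -> square_integrable h ->
  torus_inner l h (fun x => \sum_(i <- s) c i * F i x) =
  \sum_(i <- s) cj (c i) * torus_inner l h (F i).
Proof.
move=> Fi hi; rewrite torus_innerJ//; last first.
  by apply: square_integrable_sum => j; exact: square_integrableZ.
rewrite torus_inner_sum// conj_sum; apply: eq_bigr => i _.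
by rewrite conjM -torus_innerJ.
Qed.

Lemma torus_inner_self f : torus_inner l f f = (normsq f)%:C.
Proof.
rewrite /torus_inner /torus_integral; apply: complex_eqP => /=.
  by apply: eq_Rintegral => x _; rewrite mulcJ.
under eq_Rintegral do rewrite mulcJ/=.
by rewrite Rintegral_cst ?mul0r//; exact: mD.
Qed.

Lemma normsq_ge0 f : 0 <= normsq f.
Proof. by apply: Rintegral_ge0 => x _; exact: sqr_ge0. Qed.

Lemma normsqB f g : square_integrable f -> square_integrable g ->
  normsq (fun x => f x - g x) = normsq f + normsq g - 2 * ReC (torus_inner l f
    g).
Proof.
move=> fi gi; have [pr _] := square_integrable_prod fi gi.
move: fi gi => [mf fi] [mg gi].
rewrite /normsq /= -RintegralD//; last exact: mD.
rewrite -RintegralZl//; last exact: mD.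
rewrite -RintegralB//; [|exact: mD|exact: (integrableD mD fi gi)|exact:
  (integrableZl mD 2 pr)].
apply: eq_Rintegral => x _.
by rewrite !normc_sqr ReM ReD ImD ReN ImN ReJ ImJ; ring.
Qed.

(** * Orthonormal families: Pythagoras, Bessel, completeness *)

Section Orthonormal.
Variables (I : eqType) (phi : I -> R * R -> R[i]).
Hypotheses (phi_L2 : forall i, square_integrable (phi i)).
Hypothesis phi_on : forall i j, torus_inner l (phi i) (phi j) = (i == j)%:R.

Definition residual (s : seq I) f x :=
  f x - \sum_(i <- s) torus_inner l f (phi i) * phi i x.

Lemma square_integrableB f g : square_integrable f -> square_integrable g ->
  square_integrable (fun x => f x - g x).
Proof.
move=> fi gi; under eq_fun do rewrite -[- _]mulN1r.
by apply: square_integrableD => //; exact: square_integrableZ.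
Qed.

Lemma torus_innerB f g h : square_integrable f -> square_integrable g ->
  square_integrable h ->
  torus_inner l (fun x => f x - g x) h = torus_inner l f h - torus_inner l g h.
Proof.
move=> fi gi hi; under eq_fun do rewrite -[- _]mulN1r.
rewrite torus_innerD ?torus_innerZ ?mulN1r//; exact: square_integrableZ.
Qed.

Lemma square_integrable_comb (s : seq I) (c : I -> R[i]) :
  square_integrable (fun x => \sum_(i <- s) c i * phi i x).
Proof. by apply: square_integrable_sum => i; exact: square_integrableZ. Qed.

Lemma residual_L2 s f : square_integrable f -> square_integrable (residual s f).
Proof. by move=> fi; apply: square_integrableB => //;
  exact: square_integrable_comb. Qed.

Lemma residual_inner s f j : uniq s -> square_integrable f ->
  torus_inner l (residual s f) (phi j) =
  if j \in s then 0 else torus_inner l f (phi j).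
Proof.
move=> us fi; rewrite torus_innerB//; last exact: square_integrable_comb.
rewrite torus_inner_sum//; under eq_bigr do rewrite phi_on.
case: ifPn => js.
  rewrite (bigD1_seq j)//= eqxx mulr1 big1 ?addr0 ?subrr// => i ij.
  by rewrite (negPf ij) mulr0.
rewrite big_seq big1 ?subr0// => i iis.
by case: eqP => [E|]; rewrite ?mulr0//; rewrite -E iis in js.
Qed.

(** Pythagoras, since the residual is orthogonal to the part removed. As an identity it serves
    twice: positivity of the left side gives Bessel, and a residual of norm zero gives equality. *)
Lemma normsq_residual s f : uniq s -> square_integrable f ->
  normsq (residual s f) =
  normsq f - \sum_(i <- s) normc (torus_inner l f (phi i)) ^+ 2.
Proof.
move=> us fi; apply: (@complexI R); rewrite -torus_inner_self.
have ri := residual_L2 s fi.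
have ci := square_integrable_comb s (fun i => torus_inner l f (phi i)).
rewrite (torus_innerJ ri ri) {1}/residual.
rewrite torus_innerB// conjB -!torus_innerJ//.
rewrite [X in _ - X]torus_inner_sumr// big_seq big1 ?subr0; last first.
  by move=> i iis; rewrite residual_inner// iis mulr0.
rewrite torus_innerB// torus_inner_self torus_inner_sum// rmorphB rmorph_sum/=.
congr (_ - _); apply: eq_bigr => i _.
by rewrite [X in _ * X]torus_innerJ// mulcJ.
Qed.

Lemma bessel s f : uniq s -> square_integrable f ->
  \sum_(i <- s) normc (torus_inner l f (phi i)) ^+ 2 <= normsq f.
Proof. by move=> us fi; rewrite -subr_ge0 -normsq_residual// normsq_ge0. Qed.

Lemma normsq_comb (s : seq I) (c : I -> R[i]) : uniq s ->
  normsq (fun x => \sum_(i <- s) c i * phi i x) =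
    \sum_(i <- s) normc (c i) ^+ 2.
Proof.
move=> us; apply: (@complexI R); rewrite -torus_inner_self.
have ci := square_integrable_comb s c.
rewrite torus_inner_sum// rmorph_sum/= big_seq [RHS]big_seq;
  apply: eq_bigr => i iis.
rewrite torus_inner_sumr// (bigD1_seq i)//= phi_on eqxx mulr1 big1 ?addr0
  ?mulcJ//.
by move=> j ji; rewrite phi_on eq_sym (negPf ji) mulr0.
Qed.

(* By Pythagoras, the distance from [g] to any combination of the family is at
   least the norm of [g]. *)
Lemma normsq_orthogonal_eq0 g : square_integrable g ->
  (forall i, torus_inner l g (phi i) = 0) ->
  (forall eps : R, 0 < eps -> exists (s : seq I) (c : I -> R[i]),
    (torus_normsq l (fun x => g x - \sum_(n <- s) c n * phi n x)%R
     < eps%:E)%E) ->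
  normsq g = 0.
Proof.
move=> gi g0 dense; apply/eqP; rewrite eq_le normsq_ge0 andbT.
apply/ler_addgt0Pl => eps eps0; rewrite addr0.
have [s [c]] := dense _ eps0.
have ci := square_integrable_comb s c.
rewrite torus_normsqE; last exact: square_integrableB.
rewrite lte_fin => /ltW; apply: le_trans.
rewrite normsqB// torus_inner_sumr// big1 => [|i _]; last by rewrite g0 mulr0.
by rewrite mulr0 subr0 lerDl normsq_ge0.
Qed.

End Orthonormal.

End TorusL2.

(** * Exponentials and eigenfunctions *)

Section Exponentials.
Variables (R : realType) (l : R * R).
Hypotheses (l1_gt0 : 0 < l.1) (l2_gt0 : 0 < l.2).
Local Notation mR := (measurableTypeR R).
Local Notation leb := (@lebesgue_measure R).
Local Notation mu := (leb \x leb)%E.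
Local Notation D := (fundamental_domain l).
Local Notation cj := Num.conj.
Local Notation ReC := complex.Re.
Local Notation ImC := complex.Im.
Local Notation J := (int * int)%type.
Local Notation mD := (measurable_fundamental_domain l).
Implicit Types f g : R * R -> R[i].

Definition expo_scale : R := (Num.sqrt (l.1 * l.2))^-1.

(** The sine is written as a wave of phase [- (pi / 2)], so that the real lemmas on waves apply to
    both parts. *)
Definition expo (k : J) (x : R * R) : R[i] :=
  (expo_scale * wave l k 0 x) +i* (expo_scale * wave l k (- (pi / 2)) x).

Lemma expo_scale_gt0 : 0 < expo_scale.
Proof. by rewrite invr_gt0 sqrtr_gt0 mulr_gt0. Qed.

Lemma expo_scale_sqr : expo_scale ^+ 2 * (l.1 * l.2) = 1.
Proof.
by rewrite exprVn sqr_sqrtr ?mulVf// ?gt_eqF ?mulr_gt0// ltW// mulr_gt0.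
Qed.

Lemma wave_cosE k x : wave l k 0 x = cos (phase l k x).
Proof. by rewrite /wave addr0. Qed.

Lemma wave_sinE k x : wave l k (- (pi / 2)) x = sin (phase l k x).
Proof. by rewrite /wave cosBpihalf. Qed.

Lemma normc_expo k x : normc (expo k x) ^+ 2 = expo_scale ^+ 2.
Proof. by rewrite normc_sqr /= wave_cosE wave_sinE !exprMn -mulrDr cos2Dsin2
  mulr1. Qed.

Lemma expoMJ k m x : expo k x * cj (expo m x) = expo_scale%:C * expo (k - m) x.
Proof.
apply: complex_eqP; rewrite ?ReM ?ImM ?ReJ ?ImJ /=;
  rewrite !wave_cosE !wave_sinE phaseB.
  by rewrite cosB; ring.
by rewrite sinB; ring.
Qed.

Definition torus_continuous f :=
  continuous (fun x => ReC (f x)) /\ continuous (fun x => ImC (f x)).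

Lemma expo_continuous k : torus_continuous (expo k).
Proof.
by split=> x; apply: cvgM; first [exact: cvg_cst|exact: wave_continuous].
Qed.

Lemma torus_continuousB f g : torus_continuous f -> torus_continuous g ->
  torus_continuous (fun x => f x - g x).
Proof.
move=> [fr fi] [gr gi]; split=> x.
  by under eq_fun do rewrite ReD ReN; apply: cvgB; [exact: fr|exact: gr].
by under eq_fun do rewrite ImD ImN; apply: cvgB; [exact: fi|exact: gi].
Qed.

Lemma torus_continuous_sum (I : Type) (s : seq I) (c : I -> R[i])
    (F : I -> R * R -> R[i]) : (forall i, torus_continuous (F i)) ->
  torus_continuous (fun x => \sum_(i <- s) c i * F i x).
Proof.
move=> cF; elim: s => [|i s [IHr IHi]].
  by under eq_fun do rewrite big_nil; split=> x; exact: cvg_cst.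
have [Fr Fi] := cF i; split=> x.
  under eq_fun do rewrite big_cons ReD ReM.
  apply: cvgD; last exact: IHr.
  by apply: cvgB; apply: cvgM; try exact: cvg_cst; [exact: Fr|exact: Fi].
under eq_fun do rewrite big_cons ImD ImM.
apply: cvgD; last exact: IHi.
by apply: cvgD; apply: cvgM; try exact: cvg_cst; [exact: Fi|exact: Fr].
Qed.

Lemma torus_continuous_measurable f : torus_continuous f -> torus_measurable f.
Proof. by move=> [fr fi]; split; exact: continuous_plane_measurable. Qed.

Lemma torus_continuous_L2 f : torus_continuous f -> square_integrable l f.
Proof.
move=> cf; split; first exact: torus_continuous_measurable.
apply: continuous_torus_integrable => // x; under eq_fun do rewrite normc_sqr.
move: cf => [fr fi].
by apply: cvgD; apply: cvgM; [exact: fr|exact: fr|exact: fi|exact: fi].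
Qed.

Lemma expo_L2 k : square_integrable l (expo k).
Proof. exact/torus_continuous_L2/expo_continuous. Qed.

Lemma expo_torus_function k : torus_function l (expo k).
Proof.
move=> x g lg; have H phi := wave_torus_function l1_gt0 l2_gt0 k phi x lg.
by rewrite /expo !H.
Qed.

Lemma torus_integral_expo k : torus_integral l (expo k) =
  (k == 0)%:R * (expo_scale^-1)%:C.
Proof.
have iw phi : mu.-integrable D (EFin \o wave l k phi).
  exact/continuous_torus_integrable/wave_continuous.
have E : torus_integral l (expo k) =
    (expo_scale * \int[mu]_(x in D) wave l k 0 x) +i*
    (expo_scale * \int[mu]_(x in D) wave l k (- (pi / 2)) x).
  by rewrite /torus_integral !RintegralZl//; exact: mD.
rewrite {}E; have [->|k0] := eqVneq k 0; last first.
  by rewrite !integral_wave_eq0// mulr0 mul0r.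
have W phi x : wave l 0 phi x = cos phi.
  by rewrite /wave /phase /omega1 /omega2/= !(mulr0, mul0r) !add0r.
under eq_Rintegral do rewrite W.
under [X in _ +i* (_ * X)]eq_Rintegral do rewrite W cosN cos_pihalf.
rewrite cos0 !Rintegral_cst//; try exact: mD.
rewrite mul0r mulr0 mul1r mul1r -[fine _]/(torus_area l) torus_areaE//.
have -> : expo_scale * (l.1 * l.2) = expo_scale^-1.
  apply: (mulIf (lt0r_neq0 expo_scale_gt0)); rewrite mulVf ?lt0r_neq0
    ?expo_scale_gt0//.
  by rewrite mulrAC -expr2 expo_scale_sqr.
by [].
Qed.

Lemma expo_orthonormal k m : torus_inner l (expo k) (expo m) = (k == m)%:R.
Proof.
rewrite /torus_inner; under eq_fun do rewrite expoMJ.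
rewrite torus_integralZ//; last first.
  have [cr ci] := expo_continuous (k - m).
  by split; exact: continuous_torus_integrable.
rewrite torus_integral_expo subr_eq0 mulrCA -rmorphM/= mulfV ?mulr1//.
by rewrite lt0r_neq0// expo_scale_gt0.
Qed.

Lemma wave_split k phi x : wave l k phi x =
  cos phi * wave l k 0 x - sin phi * wave l k (- (pi / 2)) x.
Proof. by rewrite wave_cosE wave_sinE /wave cosD; ring. Qed.

Lemma torus_inner_expoE f k : torus_continuous f ->
  torus_inner l f (expo k) =
  (expo_scale * (\int[mu]_(x in D) (ReC (f x) * wave l k 0 x) +
           \int[mu]_(x in D) (ImC (f x) * wave l k (- (pi / 2)) x))) +i*
  (expo_scale * (\int[mu]_(x in D) (ImC (f x) * wave l k 0 x) -
           \int[mu]_(x in D) (ReC (f x) * wave l k (- (pi / 2)) x))).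
Proof.
move=> [fr fi].
have iw (u : R * R -> R) phi : continuous u ->
    mu.-integrable D (EFin \o (fun x => u x * wave l k phi x)).
  move=> cu; apply: continuous_torus_integrable => // x.
  by apply: cvgM; [exact: cu|exact: wave_continuous].
have ir0 := iw _ 0 fr; have ir1 := iw _ (- (pi / 2)) fr.
have ii0 := iw _ 0 fi; have ii1 := iw _ (- (pi / 2)) fi.
rewrite -RintegralD//; last exact: mD.
rewrite -RintegralB//; last exact: mD.
rewrite -!RintegralZl//; try exact: mD.
- rewrite /torus_inner /torus_integral; congr (_ +i* _).
    by apply: eq_Rintegral => x _; rewrite ReM ReJ ImJ/=; ring.
  by apply: eq_Rintegral => x _; rewrite ImM ReJ ImJ/=; ring.
- exact: (integrableB mD ii0 ir1).
- exact: (integrableD mD ir0 ii1).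
Qed.

(** The coefficient at [k] yields two equations for the four real integrals [a], [b], [c], [d]. The
    one at [- k] yields two more, because cosine integrals are even and sine integrals odd in [k].
    So all four vanish, and real uniqueness applies to each part. *)
Lemma expo_uniqueness f : torus_function l f -> torus_continuous f ->
  (forall k, torus_inner l f (expo k) = 0) -> forall x, f x = 0.
Proof.
move=> pf cf f0; have [cr ci] := cf.
pose a k := \int[mu]_(x in D) (ReC (f x) * wave l k 0 x).
pose b k := \int[mu]_(x in D) (ImC (f x) * wave l k (- (pi / 2)) x).
pose c k := \int[mu]_(x in D) (ImC (f x) * wave l k 0 x).
pose d k := \int[mu]_(x in D) (ReC (f x) * wave l k (- (pi / 2)) x).
have phN k x : phase l (- k) x = - phase l k x by rewrite -sub0r phaseB /phase
  /omega1 /omega2/= !(mulr0, mul0r) addr0 sub0r.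
have iw (u : R * R -> R) k phi : continuous u ->
    mu.-integrable D (EFin \o (fun x => u x * wave l k phi x)).
  move=> cu; apply: continuous_torus_integrable => // x.
  by apply: cvgM; [exact: cu|exact: wave_continuous].
have wN0 k x : wave l (- k) 0 x = wave l k 0 x by rewrite !wave_cosE phN cosN.
have wNS k x : wave l (- k) (- (pi / 2)) x = - wave l k (- (pi / 2)) x.
  by rewrite !wave_sinE phN sinN.
have aN k : a (- k) = a k by apply: eq_Rintegral => x _; rewrite wN0.
have cN k : c (- k) = c k by apply: eq_Rintegral => x _; rewrite wN0.
have bN k : b (- k) = - b k.
  rewrite -[RHS]mulN1r -RintegralZl//; [|exact: mD|exact: iw].
  by apply: eq_Rintegral => x _; rewrite wNS; ring.
have dN k : d (- k) = - d k.
  rewrite -[RHS]mulN1r -RintegralZl//; [|exact: mD|exact: iw].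
  by apply: eq_Rintegral => x _; rewrite wNS; ring.
have E k : a k + b k = 0 /\ c k - d k = 0.
  have := f0 k; rewrite torus_inner_expoE// -/(a k) -/(b k) -/(c k) -/(d k).
  move=> [/eqP + /eqP]; rewrite !mulf_eq0 (gt_eqF expo_scale_gt0)/=.
  by move=> /eqP -> /eqP ->.
have Z k : [/\ a k = 0, b k = 0, c k = 0 & d k = 0].
  have [E1 E2] := E k; have [] := E (- k); rewrite aN bN cN dN => E3 E4.
  by split; lra.
have vanish (u : R * R -> R) : continuous u ->
    (forall k, \int[mu]_(x in D) (u x * wave l k 0 x) = 0) ->
    (forall k, \int[mu]_(x in D) (u x * wave l k (- (pi / 2)) x) = 0) ->
    forall k phi, \int[mu]_(x in D) (u x * wave l k phi x) = 0.
  move=> cu u0 u1 k phi; under eq_Rintegral do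
    rewrite wave_split mulrBr !(mulrCA (u _)).
  rewrite RintegralB ?RintegralZl ?u0 ?u1 ?mulr0 ?subr0//; try exact: mD.
  - exact: iw.
  - exact: iw.
  - exact: (integrableZl mD _ (iw _ k 0 cu)).
  - exact: (integrableZl mD _ (iw _ k (- (pi / 2)) cu)).
move=> x; apply: complex_eqP => /=.
  apply: (fourier_uniqueness l1_gt0 l2_gt0 (f := fun y => ReC (f y))) => //.
    by move=> y g lg; rewrite pf.
  by apply: vanish => // k; have [] := Z k.
apply: (fourier_uniqueness l1_gt0 l2_gt0 (f := fun y => ImC (f y))) => //.
  by move=> y g lg; rewrite pf.
by apply: vanish => // k; have [] := Z k.
Qed.

Lemma eigenfunction_continuous f m : laplace_eigenfunction l f m ->
  torus_continuous f.
Proof. by case=> _ [[cr _] _] [[ci _] _] _ _. Qed.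

Lemma eigenfunction_expo_orthogonal f m k : laplace_eigenfunction l f m ->
  m != omegasq l k -> torus_inner l f (expo k) = 0.
Proof.
move=> ef neq; rewrite torus_inner_expoE; last exact: eigenfunction_continuous
  ef.
case: ef => pf Cr Ci _ Hl.
have pr : torus_function l (fun y => ReC (f y)) by move=> y g lg; rewrite pf.
have pI : torus_function l (fun y => ImC (f y)) by move=> y g lg; rewrite pf.
have Hr x : - laplacian_plane (fun y => ReC (f y)) x = m * ReC (f x).
  by have := congr1 (@complex.Re R) (Hl x); rewrite ReN ReM/= mul0r subr0.
have Hi x : - laplacian_plane (fun y => ImC (f y)) x = m * ImC (f x).
  by have := congr1 (@complex.Im R) (Hl x); rewrite ImN ImM/= mul0r addr0.
have := eigenfunction_wave_orthogonal l1_gt0 l2_gt0 (k := k) _ pr Cr Hr neq.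
have := eigenfunction_wave_orthogonal l1_gt0 l2_gt0 (k := k) _ pI Ci Hi neq.
by move=> Zi Zr; rewrite !Zr !Zi addr0 subr0 mulr0.
Qed.

(** The residual has no Fourier coefficient left: those in [s] were removed, the others vanish by
    mismatch of eigenvalues. The equality holds at every point, so it can be substituted inside
    integrals. *)
Lemma eigenfunction_expansion f m (s : seq J) : laplace_eigenfunction l f m ->
  uniq s -> (forall k, omegasq l k = m -> k \in s) ->
  forall x, f x = \sum_(k <- s) torus_inner l f (expo k) * expo k x.
Proof.
move=> ef us ms x; have cf := eigenfunction_continuous ef.
have fi := torus_continuous_L2 cf.
apply: subr0_eq; rewrite -/(residual l expo s f x).
apply: expo_uniqueness.
- move=> y g lg; rewrite /residual; case: ef => -> // _ _ _ _.
  by congr (_ - _); apply: eq_bigr => k _; rewrite expo_torus_function.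
- apply: torus_continuousB => //; apply: torus_continuous_sum => k.
  exact: expo_continuous.
- move=> k; rewrite residual_inner//; [|exact: expo_L2|exact: expo_orthonormal].
  case: ifPn => // ks; apply: (eigenfunction_expo_orthogonal ef).
  by apply: contra ks => /eqP E; exact: ms.
Qed.

End Exponentials.

(** * Counting dual lattice points *)

Section LatticeCounting.
Variables (R : realType) (l : R * R).
Hypotheses (l1_gt0 : 0 < l.1) (l2_gt0 : 0 < l.2).
Local Notation J := (int * int)%type.
Local Notation w1 := (omega1 l).
Local Notation w2 := (omega2 l).
Implicit Types (x y h : J) (T : R).

Definition freq (k : J) : R := Num.sqrt (omegasq l k).

Definition ball_set T : set J := [set k | freq k <= T].
Definition freq_ball T : {fset J} := fset_set (ball_set T).

Lemma omegasq_ge0 k : 0 <= omegasq l k.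
Proof. by rewrite addr_ge0 ?sqr_ge0. Qed.

Lemma freq_ge0 k : 0 <= freq k. Proof. exact: sqrtr_ge0. Qed.

Lemma freq_sqr k : freq k ^+ 2 = omegasq l k.
Proof. by rewrite sqr_sqrtr// omegasq_ge0. Qed.

Lemma omega1D x y : w1 (x + y) = w1 x + w1 y.
Proof. by rewrite /omega1 intrD mulrDr mulrDl. Qed.

Lemma omega2D x y : w2 (x + y) = w2 x + w2 y.
Proof. by rewrite /omega2 intrD mulrDr mulrDl. Qed.

Lemma omega1Mn x n : w1 (x *+ n) = n%:R * w1 x.
Proof.
elim: n => [|n IH]; first by rewrite mulr0n mul0r /omega1 mulr0 mul0r.
by rewrite mulrS omega1D IH -natr1; ring.
Qed.

Lemma omega2Mn x n : w2 (x *+ n) = n%:R * w2 x.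
Proof.
elim: n => [|n IH]; first by rewrite mulr0n mul0r /omega2 mulr0 mul0r.
by rewrite mulrS omega2D IH -natr1; ring.
Qed.

(** Lagrange's identity: after squaring, the defect is the square of a determinant. *)
Lemma freq_cauchy x y : w1 x * w1 y + w2 x * w2 y <= freq x * freq y.
Proof.
rewrite /freq -sqrtrM ?omegasq_ge0//.
have [neg|pos] := lerP (w1 x * w1 y + w2 x * w2 y) 0.
  exact: le_trans neg (sqrtr_ge0 _).
rewrite -[leLHS]gtr0_norm// -sqrtr_sqr ler_sqrt; last first.
  by rewrite mulr_ge0// omegasq_ge0.
rewrite -subr_ge0 /omegasq.
suff -> : (w1 x ^+ 2 + w2 x ^+ 2) * (w1 y ^+ 2 + w2 y ^+ 2) -
  (w1 x * w1 y + w2 x * w2 y) ^+ 2 = (w1 x * w2 y - w2 x * w1 y) ^+ 2 by exact: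
    sqr_ge0.
ring.
Qed.

Lemma freqD x y : freq (x + y) <= freq x + freq y.
Proof.
rewrite -(@ler_pXn2r _ 2)// ?nnegrE ?addr_ge0 ?freq_ge0// sqrrD !freq_sqr.
have := freq_cauchy x y; rewrite /omegasq omega1D omega2D => H; rewrite !sqrrD;
  lra.
Qed.

Lemma freqMn x n : freq (x *+ n) = n%:R * freq x.
Proof.
rewrite /freq /omegasq omega1Mn omega2Mn !exprMn -mulrDr sqrtrM ?sqr_ge0//.
by rewrite sqrtr_sqr ger0_norm.
Qed.

Definition int_range (m : nat) : seq int :=
  [seq i%:Z - m%:Z | i <- iota 0 m.*2.+1].

Lemma uniq_int_range m : uniq (int_range m).
Proof. by rewrite map_inj_uniq ?iota_uniq// => i j /addIr []. Qed.

Lemma mem_int_range m (i : int) : (i \in int_range m) = (`|i| <= m%:Z).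
Proof.
rewrite ler_norml; apply/mapP/idP => [[j]|/andP[i1 i2]].
  by rewrite mem_iota add0n => /andP[_ jm] ->; lia.
exists (absz (i + m%:Z)); last by lia.
by rewrite mem_iota; lia.
Qed.

Definition int_box (m n : nat) : seq J :=
  [seq (i, j) | i <- int_range m, j <- int_range n].

Lemma uniq_int_box m n : uniq (int_box m n).
Proof.
by apply: allpairs_uniq; rewrite ?uniq_int_range// => -[? ?] [? ?] _ _ [-> ->].
Qed.

Lemma size_int_box m n : size (int_box m n) = (m.*2.+1 * n.*2.+1)%N.
Proof. by rewrite size_allpairs !size_map !size_iota. Qed.

Lemma mem_int_box m n x : (x \in int_box m n) =
  (`|x.1| <= m%:Z) && (`|x.2| <= n%:Z).
Proof.
rewrite -!mem_int_range; apply/allpairsP/andP => [[[i j]/= [? ? ->]]//|[? ?]].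
by exists x; split=> //; exact: surjective_pairing.
Qed.

Definition dual_step1 : R := 2 * pi / l.1.
Definition dual_step2 : R := 2 * pi / l.2.

Lemma dual_step1_gt0 : 0 < dual_step1. Proof. by rewrite divr_gt0// mulr_gt0//
  pi_gt0. Qed.
Lemma dual_step2_gt0 : 0 < dual_step2. Proof. by rewrite divr_gt0// mulr_gt0//
  pi_gt0. Qed.

Lemma omega1E x : w1 x = dual_step1 * x.1%:~R. Proof. by rewrite /omega1
  /dual_step1; ring. Qed.
Lemma omega2E x : w2 x = dual_step2 * x.2%:~R. Proof. by rewrite /omega2
  /dual_step2; ring. Qed.

Lemma norm_omega1_le_freq x : `|w1 x| <= freq x.
Proof. by rewrite /freq -sqrtr_sqr ler_sqrt ?omegasq_ge0// lerDl sqr_ge0. Qed.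

Lemma norm_omega2_le_freq x : `|w2 x| <= freq x.
Proof. by rewrite /freq -sqrtr_sqr ler_sqrt ?omegasq_ge0// lerDr sqr_ge0. Qed.

Lemma int_norm_trunc (i : int) (t : R) : 0 <= t ->
  (`|i| <= (Num.trunc t)%:Z) = (`|i%:~R| <= t).
Proof.
move=> t0; rewrite -intr_norm -abszE -pmulrn -truncn_ge_nat//.
Qed.

Lemma ball_sub_box T : 0 <= T ->
  forall x, freq x <= T ->
  x \in int_box (Num.trunc (T / dual_step1)) (Num.trunc (T / dual_step2)).
Proof.
move=> T0 x xT; have := dual_step1_gt0; have := dual_step2_gt0 => s20 s10.
have [A1 A2] : 0 <= T / dual_step1 /\ 0 <= T / dual_step2 by split;
  apply: divr_ge0 => //; exact: ltW.
rewrite mem_int_box !int_norm_trunc// !ler_pdivlMr//.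
rewrite -{1}(gtr0_norm s10) -{1}(gtr0_norm s20) -!normrM.
rewrite ![_%:~R * _]mulrC -omega1E -omega2E.
by rewrite !(le_trans _ xT) ?norm_omega1_le_freq ?norm_omega2_le_freq.
Qed.

(** Both frequency components are at most T / 2 in absolute value, and two squares of T / 2 add up
    to at most T^2. *)
Lemma box_sub_ball T : 0 <= T ->
  forall x,
    x \in int_box (Num.trunc (T / 2 / dual_step1))
                  (Num.trunc (T / 2 / dual_step2)) -> freq x <= T.
Proof.
move=> T0 x; have := dual_step1_gt0; have := dual_step2_gt0 => s20 s10.
have T20 : 0 <= T / 2 by rewrite divr_ge0.
have [A1 A2] : 0 <= T / 2 / dual_step1 /\ 0 <= T / 2 / dual_step2.
  by split; apply: divr_ge0 => //; exact: ltW.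
rewrite mem_int_box !int_norm_trunc// !ler_pdivlMr//.
rewrite -{1}(gtr0_norm s10) -{1}(gtr0_norm s20) -!normrM.
rewrite ![_%:~R * _]mulrC -omega1E -omega2E => /andP[x1' x2'].
rewrite -(@ler_pXn2r _ 2)// ?nnegrE ?freq_ge0// freq_sqr /omegasq.
rewrite -(real_normK (num_real (w1 x))) -(real_normK (num_real (w2 x))).
move: (normr_ge0 (w1 x)) (normr_ge0 (w2 x)) x1' x2'.
move: `|_| `|_| => a b a0 b0 aT bT; nra.
Qed.

Lemma finite_ball_set T : finite_set (ball_set T).
Proof.
have [T0|T0] := lerP 0 T; last first.
  rewrite (_ : ball_set T = set0)//; apply/seteqP; split=> // x.
  by rewrite /ball_set /= leNgt (lt_le_trans T0 (freq_ge0 x)).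
apply: (@sub_finite_set _ _ [set` int_box (Num.trunc (T / dual_step1))
  (Num.trunc (T / dual_step2))]).
  by move=> x /(ball_sub_box T0).
exact: finite_seq.
Qed.

Lemma mem_ball T x : (x \in freq_ball T) = (freq x <= T).
Proof.
rewrite in_fset_set; last exact: finite_ball_set.
by apply/idP/idP; rewrite inE.
Qed.

Lemma natr_double1 (m : nat) : m.*2.+1%:R = 2 * m%:R + 1 :> R.
Proof. by rewrite -natr1 -muln2 natrM mulrC. Qed.

(** The 9 is 3 per side: with t = T / step, a side of the enclosing box has 2 trunc(t) + 1 points,
    at most 3 t as soon as t >= 1. *)
Lemma ball_card_ub T : 2 * dual_step1 <= T -> 2 * dual_step2 <= T ->
  #|` freq_ball T|%:R <= 9 * T ^+ 2 / (dual_step1 * dual_step2).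
Proof.
have := dual_step1_gt0; have := dual_step2_gt0 => s20 s10 T1 T2;
  have T0 : 0 <= T by lra.
have sub : (#|` freq_ball T| <=
    size (int_box (Num.trunc (T / dual_step1)) (Num.trunc (T / dual_step2))))%N.
  apply: uniq_leq_size; first exact: fset_uniq.
  by move=> x; rewrite mem_ball; exact: ball_sub_box.
have Ts1 : 0 <= T / dual_step1 by rewrite divr_ge0// ltW.
have Ts2 : 0 <= T / dual_step2 by rewrite divr_ge0// ltW.
have B1 : (Num.trunc (T / dual_step1)).*2.+1%:R <= 3 * (T / dual_step1).
  have := truncn_le (T / dual_step1); rewrite Ts1 => tr.
  have : 2 <= T / dual_step1 by rewrite ler_pdivlMr.
  by rewrite natr_double1 => ?; lra.
have B2 : (Num.trunc (T / dual_step2)).*2.+1%:R <= 3 * (T / dual_step2).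
  have := truncn_le (T / dual_step2); rewrite Ts2 => tr.
  have : 2 <= T / dual_step2 by rewrite ler_pdivlMr.
  by rewrite natr_double1 => ?; lra.
apply: (@le_trans _ _ ((3 * (T / dual_step1)) * (3 * (T / dual_step2)))).
  by apply: le_trans (ler_pM _ _ B1 B2); rewrite // -natrM -size_int_box
    ler_nat.
rewrite le_eqVlt; apply/orP; left; apply/eqP; field.
by rewrite !gt_eqF.
Qed.

(** The 4 is 2 per side: a side of the inscribed box has 2 trunc(t / 2) + 1 points, more than t /
    2. *)
Lemma ball_card_lb T : 2 * dual_step1 <= T -> 2 * dual_step2 <= T ->
  T ^+ 2 / (4 * (dual_step1 * dual_step2)) <= #|` freq_ball T|%:R.
Proof.
have := dual_step1_gt0; have := dual_step2_gt0 => s20 s10 T1 T2;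
  have T0 : 0 <= T by lra.
have sub : (size (int_box (Num.trunc (T / 2 / dual_step1)) (Num.trunc (T / 2 /
  dual_step2)))
    <= #|` freq_ball T|)%N.
  apply: uniq_leq_size; first exact: uniq_int_box.
  by move=> x; rewrite mem_ball; exact: box_sub_ball.
have tr (t : R) : 2 <= t -> t / 2 <= (Num.trunc (t / 2)).*2.+1%:R.
  move=> t2; have := truncnS_gt (t / 2).
  rewrite natr_double1 -[(Num.trunc _).+1%:R]natr1.
  by have := ler0n R (Num.trunc (t / 2)); lra.
have B1 : T / dual_step1 / 2 <= (Num.trunc (T / 2 / dual_step1)).*2.+1%:R.
  by rewrite [T / 2 / dual_step1]mulrAC; apply: tr; rewrite ler_pdivlMr.
have B2 : T / dual_step2 / 2 <= (Num.trunc (T / 2 / dual_step2)).*2.+1%:R.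
  by rewrite [T / 2 / dual_step2]mulrAC; apply: tr; rewrite ler_pdivlMr.
apply: (@le_trans _ _ ((T / dual_step1 / 2) * (T / dual_step2 / 2))).
  rewrite le_eqVlt; apply/orP; left; apply/eqP; field.
  by rewrite !gt_eqF.
have [A1 A2] : 0 <= T / dual_step1 / 2 /\ 0 <= T / dual_step2 / 2.
  by split; do 2 apply: divr_ge0 => //; exact: ltW.
apply: le_trans (ler_pM A1 A2 B1 B2) _.
by rewrite -natrM -size_int_box ler_nat.
Qed.

(** Brings counts of translated sets, which are confined to radius 2 T only, back to radius T. The
    constant is 9 * 2^2 * 4. *)
Lemma ball_card_double T : 2 * dual_step1 <= T -> 2 * dual_step2 <= T ->
  #|` freq_ball (2 * T)|%:R <= 144 * #|` freq_ball T|%:R :> R.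
Proof.
move=> T1 T2; have s12 : 0 < dual_step1 * dual_step2 by rewrite mulr_gt0
  ?dual_step1_gt0 ?dual_step2_gt0.
have T0 : 0 <= T by have := dual_step1_gt0; lra.
apply: (le_trans (ball_card_ub _ _)); [lra|lra|].
apply: le_trans (ler_wpM2l _ (ball_card_lb T1 T2)) => //.
rewrite le_eqVlt; apply/orP; left; apply/eqP; field.
by rewrite !gt_eqF ?dual_step1_gt0 ?dual_step2_gt0.
Qed.

(* The translates [E + j m v], [j < M], are pairwise disjoint. *)
Lemma translates_card (E F : {fset J}) v (m M : nat) :
  (forall x n, x \in E -> (m <= n)%N -> x + v *+ n \notin E) ->
  (forall x j, x \in E -> (j < M)%N -> x + v *+ (m * j) \in F) ->
  (M * #|` E| <= #|` F|)%N.
Proof.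
move=> sep EF.
pose t : seq J := [seq x + v *+ (m * j) | j <- iota 0 M, x <- enum_fset E].
have -> : (M * #|` E|)%N = size t by rewrite size_allpairs size_iota.
apply: uniq_leq_size.
  apply: allpairs_uniq; [exact: iota_uniq|exact: fset_uniq|].
  have aux i j x y : x \in E -> y \in E -> (i < j)%N ->
      x + v *+ (m * i) = y + v *+ (m * j) -> False.
    move=> xE yE ij; rewrite -(subnKC (ltnW ij)) mulnDr mulrnDr addrA addrAC.
    move=> /addIr xy; move: (sep y (m * (j - i))%N yE).
    by rewrite -xy xE leq_pmulr ?subn_gt0// => /(_ isT).
  move=> _ _ /allpairsP[[i x] /= [_ xE ->]] /allpairsP[[j y] /= [_ yE ->]] /=
    E0.
  have [ij|ij|ij] := ltngtP i j.
  - by case: (aux _ _ _ _ xE yE ij E0).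
  - by case: (aux _ _ _ _ yE xE ij (esym E0)).
  - by move: E0; rewrite ij => /addIr ->.
by move=> _ /allpairsP[[j x] /= [+ xE ->]]; rewrite mem_iota => /andP[_ jM];
  exact: EF.
Qed.

(** The sparsity criterion for both the strip and its complement. Recurrence along [v] within fewer
    than [m] steps is allowed, and [m] may grow with [T] as long as [M] jumps of [m] steps fit into
    length [T]. *)
Lemma separated_card (E : {fset J}) v (m M : nat) T :
  (forall x, x \in E -> freq x <= T) ->
  (forall x n, x \in E -> (m <= n)%N -> x + v *+ n \notin E) ->
  M%:R * m%:R * freq v <= T ->
  (M * #|` E| <= #|` freq_ball (2 * T)|)%N.
Proof.
move=> ET sep MT; apply: (translates_card sep) => x j xE jM.
rewrite mem_ball mulr2n mulrDl mul1r; apply: le_trans (freqD _ _) _.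
apply: lerD; first exact: ET.
rewrite freqMn; apply: le_trans MT; rewrite ler_wpM2r ?freq_ge0//.
by rewrite -natrM ler_nat mulnC leq_mul2r ltnW ?orbT.
Qed.

(** * Sparsity of the frequencies selected by a fixed nonzero shift *)

Section Shift.
Variable h : J.
Hypothesis h0 : h != 0.

(** [along] and [across] are the coordinates of the frequency vector of [x] parallel and
    perpendicular to [h], both multiplied by |h|; left unnormalised, they obey polynomial
    identities. *)
Definition along (x : J) : R := w1 x * w1 h + w2 x * w2 h.
Definition across (x : J) : R := w2 x * w1 h - w1 x * w2 h.
Local Notation H := (omegasq l h).

Lemma omegasq_gt0 : 0 < H.
Proof. by rewrite lt_neqAle omegasq_ge0 andbT eq_sym omegasq_eq0. Qed.

Lemma along_across x : along x ^+ 2 + across x ^+ 2 = H * freq x ^+ 2.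
Proof. by rewrite freq_sqr /along /across /omegasq; ring. Qed.

Lemma alongD x n : along (x + h *+ n) = along x + n%:R * H.
Proof. by rewrite /along omega1D omega2D omega1Mn omega2Mn /omegasq; ring. Qed.

Lemma acrossD x n : across (x + h *+ n) = across x.
Proof. by rewrite /across omega1D omega2D omega1Mn omega2Mn; ring. Qed.

Lemma freq_gt0_across x : across x != 0 -> 0 < freq x.
Proof.
move=> ax; rewrite lt_neqAle freq_ge0 andbT eq_sym; apply/eqP => f0.
have := along_across x; rewrite f0 expr0n mulr0 => E.
have : across x ^+ 2 = 0.
  by apply/eqP; rewrite eq_le sqr_ge0 andbT -E lerDr sqr_ge0.
by move/eqP; rewrite expf_eq0 (negPf ax).
Qed.

(* This and the next lemma bound the difference by the slopes, at both ends, of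
   the convex function [freq] restricted to the line through [x] and [x + h]. *)
Lemma freq_shift_lb x : across x != 0 ->
  along x / freq x <= freq (x + h) - freq x.
Proof.
move=> ax; have fx := freq_gt0_across ax.
rewrite ler_pdivrMr// mulrBl -expr2 freq_sqr.
have := freq_cauchy (x + h) x; rewrite omega1D omega2D /along /omegasq => E;
  lra.
Qed.

Lemma freq_shift_ub x : across x != 0 ->
  freq (x + h) - freq x <= along (x + h) / freq (x + h).
Proof.
move=> ax; have fx : 0 < freq (x + h).
  by apply: freq_gt0_across; have /= := acrossD x 1; rewrite mulr1n => ->.
rewrite ler_pdivlMr// mulrBl -expr2 freq_sqr.
have := freq_cauchy x (x + h); rewrite omega1D omega2D /along omega1D omega2D
  /omegasq omega1D omega2D => E; lra.
Qed.

(** Quantitative strict convexity: [along x / freq x] is the slope of [freq] per step [h]. After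
    clearing denominators ([K]), the excess over the claimed bound is n (H |x| |y| - along x * along
    y), nonnegative by [C]. *)
Lemma along_freq_diff x n : across x != 0 ->
  n%:R * across x ^+ 2 /
    (freq x * freq (x + h *+ n) * (freq x + freq (x + h *+ n)))
  <= along (x + h *+ n) / freq (x + h *+ n) - along x / freq x.
Proof.
set y := x + h *+ n => ax.
have ay : across y != 0 by rewrite /y acrossD.
have fx := freq_gt0_across ax; have fy := freq_gt0_across ay.
have Ex := along_across x; have Ey := along_across y.
have Uy := alongD x n; rewrite -/y in Uy; have Vy : across y =
  across x by rewrite /y acrossD.
have C : along x * along y <= H * (freq x * freq y).
  have hC : (along x * along y) ^+ 2 <= (H * (freq x * freq y)) ^+ 2.
    have -> : (H * (freq x * freq y)) ^+ 2 = (H * freq x ^+ 2) * (H * freq y ^+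
      2) by ring.
    rewrite -Ex -Ey exprMn.
    by apply: ler_pM; rewrite ?sqr_ge0// lerDl sqr_ge0.
  have Hp : 0 <= H * (freq x * freq y) by rewrite !mulr_ge0 ?freq_ge0// ltW//
    omegasq_gt0.
  by rewrite (le_trans (ler_norm _))// -(ger0_norm Hp) -!sqrtr_sqr ler_sqrt//
    sqr_ge0.
have K : (along y / freq y - along x / freq x) * (freq x * freq y * (freq x +
  freq y)) =
    n%:R * (across x ^+ 2 + (H * (freq x * freq y) - along x * along y)).
  have -> : (along y / freq y - along x / freq x) * (freq x * freq y * (freq x +
    freq y)) =
    along y * freq x ^+ 2 + (along y - along x) * (freq x * freq y) - along x *
      freq y ^+ 2.
    by field; rewrite !gt_eqF.
  (* A factor [H] lets [along_across] eliminate the squared frequencies; what remains is a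
     polynomial identity. *)
  apply: (mulfI (lt0r_neq0 omegasq_gt0)).
  have -> : H * (along y * freq x ^+ 2 + (along y - along x) * (freq x * freq y)
    -
    along x * freq y ^+ 2) = along y * (H * freq x ^+ 2) + (along y - along x) *
      (H * (freq x * freq y)) - along x * (H * freq y ^+ 2) by ring.
  by rewrite -Ex -Ey Vy Uy; ring.
rewrite ler_pdivrMr ?mulr_gt0 ?addr_gt0// K ler_wpM2l// lerDl; lra.
Qed.

(** The increments of [freq] at [x] and at [y] differ by less than 2 delta, as tau cancels. They are
    compared with the slopes at [x + h] and at [y], which are [n] steps apart: hence [n.+1] in the
    hypotheses and [n] in the conclusion. The 12 is 2 * 6, where 6 T^3 = 2 T * T * 3 T bounds the
    denominator [P]. *)
Lemma shift_far_apart x n T tau delta zeta :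
  omegasq l h <= T ^+ 2 -> 0 < T -> 0 < zeta ->
  freq (x + h *+ n.+1) <= T -> freq x <= T -> zeta * T <= `|across x| ->
  `|freq x - freq (x + h) - tau| < delta ->
  `|freq (x + h *+ n.+1) - freq (x + h *+ n.+1 + h) - tau| < delta ->
  n%:R * zeta ^+ 2 < 12 * delta * T.
Proof.
move=> HT T0 z0; set y := x + h *+ n.+1 => yT xT zT.
have ax : across x != 0 by rewrite -normr_gt0 (lt_le_trans _ zT)// mulr_gt0.
have ay : across y != 0 by rewrite /y acrossD.
have ax1 : across (x + h) != 0 by have := acrossD x 1; rewrite mulr1n => ->.
have yE : y = (x + h) + h *+ n by rewrite /y mulrS addrA.
have hT : freq h <= T.
  by rewrite -(@ler_pXn2r _ 2)// ?nnegrE ?freq_ge0 ?freq_sqr// ltW.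
have zT2 : freq (x + h) <= 2 * T by have := freqD x h; lra.
have D1 := freq_shift_ub ax; have D2 := freq_shift_lb ay.
have := along_freq_diff n ax1; rewrite -yE => D3.
have f1 := freq_gt0_across ax1; have f2 := freq_gt0_across ay.
rewrite !ltr_norml => /andP[X1 X2] /andP[Y1 Y2].
set P := freq (x + h) * freq y * (freq (x + h) + freq y) in D3.
have P0 : 0 < P by rewrite /P !mulr_gt0// addr_gt0.
have PT : P <= 6 * T ^+ 3.
  have -> : 6 * T ^+ 3 = (2 * T) * T * (2 * T + T) by ring.
  by rewrite /P !ler_pM ?mulr_ge0 ?addr_ge0 ?freq_ge0 ?lerD.
have a2 : (zeta * T) ^+ 2 <= across (x + h) ^+ 2.
  have -> : across (x + h) = across x by have := acrossD x 1; rewrite mulr1n.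
  rewrite -(real_normK (num_real (across x))) lerXn2r ?nnegrE ?normr_ge0//.
  by rewrite mulr_ge0 ?ltW.
have D4 : n%:R * across (x + h) ^+ 2 / P < 2 * delta.
  by apply: le_lt_trans D3 _; lra.
rewrite ltr_pdivrMr// in D4.
have d0 : 0 < delta by lra.
have : n%:R * (zeta * T) ^+ 2 < 2 * delta * (6 * T ^+ 3).
  apply: (@le_lt_trans _ _ (n%:R * across (x + h) ^+ 2)).
    by rewrite ler_wpM2l.
  by apply: lt_le_trans D4 _; rewrite ler_wpM2l// mulr_ge0// ltW.
have -> : n%:R * (zeta * T) ^+ 2 = (n%:R * zeta ^+ 2) * T ^+ 2 by ring.
have -> : 2 * delta * (6 * T ^+ 3) = (12 * delta * T) * T ^+ 2 by ring.
by rewrite ltr_pM2r// exprn_gt0.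
Qed.

(** One of the two basis vectors is not parallel to [h]. *)
Lemma exists_transverse : exists v : J, 0 < `|across v|.
Proof.
have [h1|h1] := eqVneq (w1 h) 0.
  exists (1, 0); rewrite normr_gt0 /across h1 mulr0 sub0r oppr_eq0.
  apply: mulf_neq0; first by rewrite omega1E mulr1 gt_eqF// dual_step1_gt0.
  by apply/eqP => h2; have := omegasq_gt0; rewrite /omegasq h1 h2 expr0n addr0
    ltxx.
exists (0, 1); rewrite normr_gt0 /across (omega1E (0, 1)) mulr0 mul0r subr0.
by rewrite mulf_neq0// omega2E mulr1 gt_eqF// dual_step2_gt0.
Qed.

Lemma across_shift x v n : across (x + v *+ n) = across x + n%:R * across v.
Proof. by rewrite /across omega1D omega2D omega1Mn omega2Mn; ring. Qed.

(** Each step [v] changes [across] by [eta] in absolute value, so more than 2 zeta T / eta steps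
    leave the strip. [zeta] makes [M.+1] such jumps cost T / 2 in length; [T0] makes the rounding of
    the number of steps cost at most the other T / 2. *)
Lemma strip_card (M : nat) : exists zeta T0 : R, [/\ 0 < zeta, 0 < T0 &
  forall T (E : {fset J}), T0 <= T ->
    (forall x, x \in E -> freq x <= T /\ `|across x| < zeta * T) ->
    (M * #|` E| <= #|` freq_ball (2 * T)|)%N].
Proof.
have [v av] := exists_transverse.
set eta := `|across v| in av.
have fv : 0 < freq v.
  by apply: freq_gt0_across; rewrite -normr_gt0.
pose zeta := eta / (4 * (M.+1%:R * freq v)).
have MF0 : 0 < M.+1%:R * freq v by rewrite mulr_gt0.
have z0 : 0 < zeta by rewrite divr_gt0// mulr_gt0.
exists zeta, (2 * (M.+1%:R * freq v)); split=> //; first by rewrite mulr_gt0.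
move=> T E T0 EP.
have Tp : 0 < T by apply: lt_le_trans T0; rewrite mulr_gt0.
pose m := (Num.trunc (2 * zeta * T / eta)).+1.
have q0 : 0 <= 2 * zeta * T / eta by apply: ltW; apply: divr_gt0 => //;
  do 2 apply: mulr_gt0 => //.
have mlb : 2 * zeta * T < m%:R * eta.
  by rewrite -ltr_pdivrMr// truncnS_gt.
have mub : m%:R <= 2 * zeta * T / eta + 1.
  by have := truncn_le (2 * zeta * T / eta); rewrite q0 /m -natr1 => ?; lra.
apply: (@separated_card E v m M T) => [x /EP[]//|x n xE mn|].
  apply/negP => /EP[_]; have [_] := EP _ xE.
  rewrite across_shift => X Y.
  have : `|n%:R * across v| < 2 * zeta * T.
    have -> : n%:R * across v = (across x + n%:R * across v) - across x by ring.
    by apply: le_lt_trans (ler_normB _ _) _; lra.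
  rewrite normrM normr_nat -/eta ltNge => /negP; apply.
  by apply: ltW (lt_le_trans mlb _); rewrite ler_pM2r// ler_nat.
have E1 : 2 * zeta * T / eta * (M.+1%:R * freq v) = T / 2.
  by rewrite /zeta; field; rewrite !gt_eqF//= ltr0Sn.
apply: (@le_trans _ _ (m%:R * (M.+1%:R * freq v))).
  rewrite mulrA [m%:R * _]mulrC ler_wpM2r ?freq_ge0// ler_wpM2r//.
  by rewrite ler_nat.
apply: le_trans (ler_wpM2r (ltW MF0) mub) _.
by rewrite mulrDl E1 mul1r; lra.
Qed.

(** The translates go along [h] itself, and [shift_far_apart] forbids recurrence after about 12
    delta T / zeta^2 steps. [delta] makes [M.+1] such jumps cost T / 2. Two extra steps, one from
    rounding and one from the offset in that lemma, account for the 4 in the threshold. *)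
Lemma cone_card (M : nat) zeta : 0 < zeta -> exists delta T0 : R,
  [/\ 0 < delta, 0 < T0 &
  forall (T tau : R) (E : {fset J}), T0 <= T ->
    (forall x, x \in E -> [/\ freq x <= T, zeta * T <= `|across x| &
      `|freq x - freq (x + h) - tau| < delta]) ->
    (M * #|` E| <= #|` freq_ball (2 * T)|)%N].
Proof.
move=> z0.
have fh : 0 < freq h by rewrite sqrtr_gt0 omegasq_gt0.
have MF0 : 0 < M.+1%:R * freq h by rewrite mulr_gt0.
pose delta := zeta ^+ 2 / (24 * (M.+1%:R * freq h)).
have d0 : 0 < delta by rewrite divr_gt0 ?exprn_gt0// mulr_gt0.
exists delta, (4 * (M.+1%:R * freq h)); split=> //; first by rewrite mulr_gt0.
move=> T tau E T0 EP.
have Tp : 0 < T by apply: lt_le_trans T0; rewrite mulr_gt0.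
have HT : omegasq l h <= T ^+ 2.
  rewrite -freq_sqr lerXn2r ?nnegrE ?freq_ge0//; first exact: ltW.
  apply: le_trans T0; rewrite mulrA -[leLHS]mul1r ler_wpM2r ?freq_ge0//.
  by rewrite -natrM ler1n.
pose m0 := (Num.trunc (12 * delta * T / zeta ^+ 2)).+1.
have z20 : 0 < zeta ^+ 2 by rewrite exprn_gt0.
have q0 : 0 <= 12 * delta * T / zeta ^+ 2 by apply: ltW; apply: divr_gt0 => //;
  do 2 apply: mulr_gt0 => //.
have mlb : 12 * delta * T < m0%:R * zeta ^+ 2.
  by rewrite -ltr_pdivrMr// truncnS_gt.
have mub : m0%:R <= 12 * delta * T / zeta ^+ 2 + 1.
  by have := truncn_le (12 * delta * T / zeta ^+ 2);
    rewrite q0 /m0 -natr1 => ?; lra.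
apply: (@separated_card E h m0.+1 M T) => [x /EP[]//|x n xE mn|].
  case: n mn => // n; rewrite ltnS => mn; apply/negP => /EP[Y1 Y2 Y3].
  have [X1 X2 X3] := EP _ xE.
  have := shift_far_apart HT Tp z0 Y1 X1 X2 X3 Y3.
  rewrite ltNge => /negP; apply.
  by apply: ltW (lt_le_trans mlb _); rewrite ler_pM2r// ler_nat.
have E1 : 12 * delta * T / zeta ^+ 2 * (M.+1%:R * freq h) = T / 2.
  by rewrite /delta; field; rewrite !gt_eqF//= ltr0Sn.
apply: (@le_trans _ _ (m0.+1%:R * (M.+1%:R * freq h))).
  rewrite mulrA [m0.+1%:R * _]mulrC ler_wpM2r ?freq_ge0// ler_wpM2r//.
  by rewrite ler_nat.
have mub2 : m0.+1%:R <= 12 * delta * T / zeta ^+ 2 + 2.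
  by rewrite -natr1; lra.
apply: le_trans (ler_wpM2r (ltW MF0) mub2) _.
by rewrite mulrDl E1; lra.
Qed.

(** The order of choices is [M], then the strip width [zeta], then [delta], which depends on [zeta].
    The 288 is 2 * 144: two pieces, each compared with the ball of radius 2 T. *)
Lemma shift_density (eps : R) : 0 < eps -> exists delta T0 : R,
  [/\ 0 < delta, 0 < T0 &
  forall T tau : R, T0 <= T ->
    #|` [fset k in freq_ball T |
          (`|freq k - freq (k + h) - tau| < delta)%R]%fset|%:R
      <= eps * #|` freq_ball T|%:R].
Proof.
move=> e0; pose M := (Num.trunc (288 / eps)).+1.
have Me : 288 < eps * M%:R.
  by rewrite mulrC -ltr_pdivrMr// truncnS_gt.
have [zeta [T1 [z0 T10 strip]]] := strip_card M.
have [delta [T2 [d0 T20 cone]]] := cone_card M z0.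
exists delta, (Num.max (Num.max T1 T2) (Num.max (2 * dual_step1) (2 *
  dual_step2))).
split=> //; first by rewrite !lt_max T10.
move=> T tau; rewrite !ge_max => /andP[/andP[TT1 TT2] /andP[TT3 TT4]].
set S := [fset k in _ | _]%fset.
pose A := [fset k in S | (`|across k| < zeta * T)%R]%fset.
pose B := [fset k in S | ~~ (`|across k| < zeta * T)%R]%fset.
have SE : (#|` S| <= #|` A| + #|` B|)%N.
  apply: (@leq_trans #|` (A `|` B)%fset|); last by rewrite cardfsU leq_subr.
  apply/fsubset_leq_card/fsubsetP => x xS; rewrite !inE/= in xS *.
  by rewrite xS/= orbN.
have cA : (M * #|` A| <= #|` freq_ball (2 * T)|)%N.
  apply: (strip T) => // x; rewrite !inE/= mem_ball => /andP[/andP[xT _] xs].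
  by split.
have cB : (M * #|` B| <= #|` freq_ball (2 * T)|)%N.
  apply: (cone T tau) => // x; rewrite !inE/= mem_ball -leNgt.
  by move=> /andP[/andP[xT xd] xs]; split.
have dbl := ball_card_double TT3 TT4.
have : (M * #|` S|)%:R <= 288 * #|` freq_ball T|%:R :> R.
  apply: (@le_trans _ _ (#|` freq_ball (2 * T)| + #|` freq_ball (2 * T)|)%:R).
    by rewrite ler_nat (leq_trans (leq_mul (leqnn M) SE))// mulnDr leq_add.
  by rewrite natrD; lra.
rewrite natrM => MS.
have M0 : 0 < M%:R :> R by rewrite ltr0n.
rewrite -(ler_pM2l M0); apply: le_trans MS _.
by rewrite mulrA [M%:R * eps]mulrC ler_wpM2r// ltW.
Qed.

End Shift.

End LatticeCounting.

(** * Comparison of the two eigenbases *)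

Section Spectrum.
Variables (R : realType) (l : R * R).
Hypotheses (l1_gt0 : 0 < l.1) (l2_gt0 : 0 < l.2).
Variables (I : choiceType) (psi : I -> R * R -> R[i]) (lam : I -> R).
Hypothesis psi_basis : orthonormal_basis l psi.
Hypothesis lam_ge0 : forall n, 0 <= lam n.
Hypothesis psi_eigen : forall n, laplace_eigenfunction l (psi n) (lam n ^+ 2).
Local Notation cj := Num.conj.
Local Notation J := (int * int)%type.
Local Notation e := (expo l).
Local Notation fq := (freq l).
Local Notation B := (freq_ball l).

Definition coef (n : I) (k : J) : R[i] := torus_inner l (psi n) (e k).

Lemma psi_L2 n : square_integrable l (psi n).
Proof. by case: psi_basis => H _ _; exact: torus_L2_square_integrable. Qed.

Lemma psi_orthonormal m n : torus_inner l (psi m) (psi n) = (m == n)%:R.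
Proof. by case: psi_basis. Qed.

Let eL2 := expo_L2 l1_gt0 l2_gt0.
Let eON := expo_orthonormal l1_gt0 l2_gt0.

Lemma coef_eq0 n k : lam n != fq k -> coef n k = 0.
Proof.
move=> neq; apply: (eigenfunction_expo_orthogonal l1_gt0 l2_gt0 (psi_eigen n)).
apply: contra neq => /eqP E; apply/eqP.
by rewrite /freq -E sqrtr_sqr ger0_norm.
Qed.

Lemma psi_expansion n T : lam n <= T ->
  psi n = fun x => \sum_(k <- B T) coef n k * e k x.
Proof.
move=> nT; apply/funext; apply: (eigenfunction_expansion l1_gt0 l2_gt0
  (psi_eigen n)).
  exact: fset_uniq.
move=> k E; rewrite mem_ball//; suff -> : fq k = lam n by [].
by rewrite /freq E sqrtr_sqr ger0_norm.
Qed.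

Lemma coef_row n T : lam n <= T -> \sum_(k <- B T) normc (coef n k) ^+ 2 = 1.
Proof.
move=> nT; rewrite -(normsq_comb eL2 eON) ?fset_uniq//; apply: (@complexI R).
rewrite -psi_expansion// -torus_inner_self//.
by rewrite psi_orthonormal eqxx.
Qed.

Lemma normsq_expo k : normsq l (e k) = 1.
Proof. by apply: (@complexI R); rewrite -torus_inner_self// eON eqxx. Qed.

Lemma coef_conj n k : torus_inner l (e k) (psi n) = cj (coef n k).
Proof. by rewrite torus_innerJ//; exact: psi_L2. Qed.

Lemma coef_column (s : seq I) k : uniq s ->
  \sum_(n <- s) normc (coef n k) ^+ 2 <= 1.
Proof.
move=> us; rewrite -(normsq_expo k).
apply: le_trans (bessel psi_L2 psi_orthonormal us (eL2 k)).
by apply: ler_sum => n _; rewrite coef_conj normc_sqrJ.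
Qed.

(** Here density of the span of [psi] enters. The residual of [e k] is orthogonal to every [psi n],
    by removal or by mismatch of frequencies, hence has norm zero, and Pythagoras becomes an
    equality. *)
Lemma coef_column_full (s : seq I) k : uniq s ->
  (forall n, lam n = fq k -> n \in s) ->
  \sum_(n <- s) normc (coef n k) ^+ 2 = 1.
Proof.
move=> us full.
set g := residual l psi s (e k).
have gi : square_integrable l g by apply: residual_L2 => //; exact: psi_L2.
have g0 n : torus_inner l g (psi n) = 0.
  rewrite residual_inner//; [|exact: psi_L2|exact: psi_orthonormal].
  case: ifPn => // ns; rewrite coef_conj coef_eq0 ?conjC0//.
  by apply: contra ns => /eqP /full.
have gL2 : torus_L2 l g.
  case: gi => -[mr mi] gi; split=> //.
    move=> x y ly; rewrite /g /residual expo_torus_function//; congr (_ - _).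
    apply: eq_bigr => n _; congr (_ * _).
    by case: (psi_eigen n) => + _ _ _ _; apply.
  rewrite torus_normsqE ?ltry//.
have dense : forall eps : R, 0 < eps -> exists (s : seq I) (c : I -> R[i]),
    (torus_normsq l (fun x => g x - \sum_(n <- s) c n * psi n x)%R < eps%:E)%E.
  by case: psi_basis => _ _; apply.
have /eqP := normsq_orthogonal_eq0 psi_L2 gi g0 dense.
rewrite normsq_residual//; [|exact: psi_L2|exact: psi_orthonormal].
rewrite normsq_expo subr_eq0 => /eqP E; rewrite [RHS]E.
by apply: eq_bigr => n _; rewrite coef_conj normc_sqrJ.
Qed.

(** The mass of |U|^2 counted in two ways: each row in [s] has mass 1, each column at most 1. For
    arbitrary finite lists, so that finiteness of the spectrum can be deduced from it. *)
Lemma eigenvalue_seq_size (s : seq I) T : uniq s ->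
  (forall n, n \in s -> lam n <= T) -> (size s <= #|` B T|)%N.
Proof.
move=> us sT; rewrite -(ler_nat R).
have -> : (size s)%:R = \sum_(n <- s) \sum_(k <- B T) normc (coef n k) ^+ 2 :>
  R.
  rewrite big_seq (eq_bigr (fun=> 1)) => [|n ns]; last by rewrite coef_row// sT.
  by rewrite -big_seq big_const_seq count_predT iter_addr addr0.
rewrite exchange_big/=; apply: (@le_trans _ _ (\sum_(k <- B T) 1)).
  by apply: ler_sum => k _; exact: coef_column.
by rewrite big_const_seq count_predT iter_addr addr0.
Qed.

Lemma finite_eigenvalues T : finite_set [set n | lam n <= T].
Proof.
apply: contrapT => /(infinite_set_fset (#|` B T|.+1))[F FT].
rewrite ltnNge => /negP; apply.
apply: eigenvalue_seq_size; first exact: fset_uniq.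
by move=> n /FT.
Qed.

Definition eigen_fset T : {fset I} := fset_set [set n | lam n <= T].

Lemma mem_eigen_fset T n : (n \in eigen_fset T) = (lam n <= T).
Proof.
rewrite in_fset_set; last exact: finite_eigenvalues.
by apply/idP/idP; rewrite inE.
Qed.

(** The reverse count uses that columns have full mass 1; no eigenspaces have to be matched. *)
Lemma eigenvalue_countE T : eigenvalue_count lam T = #|` B T|.
Proof.
apply/eqP; rewrite eqn_leq; apply/andP; split.
  apply: eigenvalue_seq_size; first exact: fset_uniq.
  by move=> n; rewrite mem_eigen_fset.
rewrite -(ler_nat R).
have -> : #|` B T|%:R = \sum_(k <- B T) \sum_(n <- eigen_fset T) normc (coef n
  k) ^+ 2 :> R.
  rewrite big_seq (eq_bigr (fun=> 1)) => [|k kT].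
    by rewrite -big_seq big_const_seq count_predT iter_addr addr0.
  rewrite coef_column_full ?fset_uniq// => n nk.
  by rewrite mem_eigen_fset nk; rewrite mem_ball in kT.
rewrite exchange_big/=; apply: (@le_trans _ _ (\sum_(n <- eigen_fset T) 1)).
  rewrite big_seq [leRHS]big_seq; apply: ler_sum => n nT.
  by rewrite coef_row// -mem_eigen_fset.
by rewrite big_const_seq count_predT iter_addr addr0.
Qed.

(** Bessel for [psi], applied to the trigonometric polynomial with coefficients conj c: its products
    with the [psi n] are the conjugates of the entries of U c. *)
Lemma coef_contraction (s : seq I) T (c : J -> R[i]) : uniq s ->
  \sum_(n <- s) normc (\sum_(k <- B T) coef n k * c k) ^+ 2 <=
  \sum_(k <- B T) normc (c k) ^+ 2.
Proof.
move=> us.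
have -> : \sum_(k <- B T) normc (c k) ^+ 2 =
    normsq l (fun x => \sum_(k <- B T) cj (c k) * e k x).
  by rewrite normsq_comb//; apply: eq_bigr => k _; rewrite normc_sqrJ.
have fi : square_integrable l (fun x => \sum_(k <- B T) cj (c k) * e k x).
  exact: square_integrable_comb.
apply: le_trans (bessel psi_L2 psi_orthonormal us fi).
apply: ler_sum => n _; rewrite torus_inner_sum//; last exact: psi_L2.
rewrite -normc_sqrJ conj_sum.
by under eq_bigr do rewrite conjM mulrC -coef_conj.
Qed.

Lemma coef_contractionJ (s : seq I) T (c : J -> R[i]) : uniq s ->
  \sum_(n <- s) normc (\sum_(k <- B T) cj (coef n k) * c k) ^+ 2 <=
  \sum_(k <- B T) normc (c k) ^+ 2.
Proof.
move=> us; under [leRHS]eq_bigr do rewrite -normc_sqrJ.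
apply: le_trans (coef_contraction T (fun k => cj (c k)) us).
apply: ler_sum => n _; rewrite -normc_sqrJ conj_sum.
by under eq_bigr do rewrite conjM conjCK.
Qed.

(** * Matrix elements of multiplication by a square integrable function *)

Section MatrixElements.
Variable b : R * R -> R[i].
Hypothesis b_L2 : square_integrable l b.

Definition matrix_elem (f g : R * R -> R[i]) : R[i] :=
  torus_inner l (fun x => b x * f x) g.

Lemma mul_expo_L2 k : square_integrable l (fun x => b x * e k x).
Proof.
apply: (square_integrable_bounded (M := expo_scale l ^+ 2)) => //.
  exact/torus_continuous_measurable/expo_continuous.
by move=> x; rewrite normc_expo.
Qed.

Lemma matrix_elem_expo k m : matrix_elem (e k) (e m) =
  (expo_scale l)%:C * torus_inner l b (e (m - k)).
Proof.
rewrite /matrix_elem /torus_inner -torus_integralZ//;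
  last exact: square_integrable_prod.
congr torus_integral; apply/funext => x.
have E : e k x * cj (e m x) = (expo_scale l)%:C * cj (e (m - k) x).
  by rewrite -[e k x]conjCK -conjM mulrC expoMJ// conjM [cj _%:C]conjc_real.
by rewrite -mulrA E mulrCA.
Qed.

Lemma matrix_elem_psi i j T : lam i <= T -> lam j <= T ->
  matrix_elem (psi i) (psi j) =
  \sum_(m <- B T) cj (coef j m) * \sum_(k <- B T) coef i k * matrix_elem (e k)
    (e m).
Proof.
move=> iT jT; rewrite /matrix_elem (psi_expansion iT) (psi_expansion jT).
under eq_fun do rewrite mulr_sumr.
under eq_fun do under eq_bigr do rewrite mulrCA.
rewrite torus_inner_sumr//; last first.
  apply: square_integrable_sum => // k; apply: square_integrableZ => //.
  exact: mul_expo_L2.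
apply: eq_bigr => m _; congr (_ * _).
by rewrite torus_inner_sum// => k; exact: mul_expo_L2.
Qed.

(* Eigenfunctions only see exponentials of their own frequency, so a condition
   on the pair of eigenvalues can be moved onto the pair of frequencies; the
   change of basis then is a contraction on both sides. *)
Lemma matrix_elem_sum_le (Q : R -> R -> bool) T :
  \sum_(i <- eigen_fset T) \sum_(j <- eigen_fset T | Q (lam i) (lam j))
     normc (matrix_elem (psi i) (psi j)) ^+ 2 <=
  \sum_(k <- B T) \sum_(m <- B T | Q (fq k) (fq m))
     normc (matrix_elem (e k) (e m)) ^+ 2.
Proof.
(* [Z] is the matrix of [b] in the exponentials, masked by [Q]; [key] says that on pairs satisfying
   [Q] it yields the same elements in [psi] as the full matrix. *)
pose Z k m := if Q (fq k) (fq m) then matrix_elem (e k) (e m) else 0.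
have key i j : i \in eigen_fset T -> j \in eigen_fset T -> Q (lam i) (lam j) ->
    matrix_elem (psi i) (psi j) =
    \sum_(m <- B T) cj (coef j m) * \sum_(k <- B T) coef i k * Z k m.
  rewrite !mem_eigen_fset => iT jT Qij; rewrite (matrix_elem_psi iT jT).
  apply: eq_bigr => m _; have [jm|jm] := eqVneq (lam j) (fq m); last first.
    by rewrite coef_eq0// conjC0 !mul0r.
  congr (_ * _); apply: eq_bigr => k _.
  have [ik|ik] := eqVneq (lam i) (fq k); last by rewrite coef_eq0// !mul0r.
  by rewrite /Z -ik -jm Qij.
(* The condition on the pair is dropped, at the price of nonnegative terms only, so that the sums
   have the form required by the contractions. *)
apply: (@le_trans _ _ (\sum_(i <- eigen_fset T) \sum_(j <- eigen_fset T)
    normc (\sum_(m <- B T) cj (coef j m) * \sum_(k <- B T) coef i k * Z k m) ^+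
      2)).
  rewrite big_seq [leRHS]big_seq; apply: ler_sum => i iT.
  rewrite big_mkcond big_seq [leRHS]big_seq; apply: ler_sum => j jT.
  by case: ifPn => [Qij|_]; [rewrite key|exact: sqr_ge0].
apply: (@le_trans _ _ (\sum_(i <- eigen_fset T) \sum_(m <- B T)
    normc (\sum_(k <- B T) coef i k * Z k m) ^+ 2)).
  by apply: ler_sum => i _; apply: coef_contractionJ; exact: fset_uniq.
rewrite exchange_big/= [leRHS](exchange_big_dep xpredT)//=.
apply: ler_sum => m _; apply: le_trans (coef_contraction _ _ _) _.
  exact: fset_uniq.
rewrite [leRHS]big_mkcond/=; apply: ler_sum => k _; rewrite /Z.
by case: ifP => //; rewrite normc_sqr0.
Qed.

End MatrixElements.

End Spectrum.

(** * Density estimates *)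

Section Density.
Variables (R : realType) (l : R * R).
Hypotheses (l1_gt0 : 0 < l.1) (l2_gt0 : 0 < l.2).
Local Notation cj := Num.conj.
Local Notation J := (int * int)%type.
Local Notation e := (expo l).
Local Notation fq := (freq l).
Local Notation B := (freq_ball l).

Lemma sum_uniq_sub (T : eqType) (s t : seq T) (F : T -> R) :
  uniq s -> uniq t -> {subset s <= t} -> (forall i, 0 <= F i) ->
  \sum_(i <- s) F i <= \sum_(i <- t) F i.
Proof.
move=> us ut st F0.
have P : perm_eq s [seq i <- t | i \in s].
  apply: uniq_perm => //; first exact: filter_uniq.
  by move=> i; rewrite mem_filter; case: (boolP (i \in s)) => // /st ->.
by rewrite (perm_big _ P) big_filter big_mkcond; apply: ler_sum => i _;
  case: ifP.
Qed.

(** Otherwise every finite list could be extended by a disjoint block of mass more than [eps], and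
    sufficiently many blocks would exceed [M]. *)
Lemma square_summable_tail (b : J -> R) M eps : 0 < eps ->
  (forall k, 0 <= b k) -> (forall s, uniq s -> \sum_(k <- s) b k <= M) ->
  exists2 H : seq J, uniq H & forall s, uniq s ->
    (forall k, k \in s -> k \notin H) -> \sum_(k <- s) b k <= eps.
Proof.
move=> e0 b0 bM; apply: contrapT => /forall2NP nH.
have step (n : nat) : exists2 H : seq J, uniq H & n%:R * eps <=
  \sum_(k <- H) b k.
  elim: n => [|n [H uH HS]]; first by exists [::]; rewrite ?mul0r ?big_nil.
  have [//|] := nH H; move=> /existsNP[s /not_implyP[us /not_implyP[sH]]].
  move=> /negP; rewrite -ltNge => ss.
  exists (s ++ H).
    rewrite cat_uniq us uH andbT /=; apply/hasPn => k kH; apply/negP => /sH.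
    by rewrite kH.
  rewrite big_cat /= -natr1 mulrDl mul1r addrC; lra.
have [H uH] := step (Num.trunc (M / eps)).+1.
apply/negP; rewrite -ltNge; apply: le_lt_trans (bM H uH) _.
by rewrite -ltr_pdivrMr// truncnS_gt.
Qed.

Variable b : R * R -> R[i].
Hypothesis b_L2 : square_integrable l b.
Hypothesis b_mean0 : torus_inner l b (e 0) = 0.

Let bt (k : J) := normc (torus_inner l b (e k)) ^+ 2.

Let bt_ge0 k : 0 <= bt k. Proof. exact: sqr_ge0. Qed.

Let bt_sum (s : seq J) : uniq s -> \sum_(k <- s) bt k <= normsq l b.
Proof.
move=> us.
exact: (bessel (expo_L2 l1_gt0 l2_gt0) (expo_orthonormal l1_gt0 l2_gt0) us
  b_L2).
Qed.

(** The smallest [delta] and the largest threshold serve all shifts of the list, because the counted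
    sets shrink with [delta]. *)
Lemma finite_shift_density (H : seq J) eps : 0 < eps ->
  exists delta T0 : R, [/\ 0 < delta, 0 < T0 &
  forall T tau : R, T0 <= T ->
    \sum_(h <- H) bt h *
      #|` [fset k in B T | (`|fq k - fq (k + h) - tau| < delta)%R]%fset|%:R
    <= eps * #|` B T|%:R * \sum_(h <- H) bt h].
Proof.
move=> e0; elim: H => [|h H [d1 [T1 [d10 T10 IH]]]].
  by exists 1, 1; split=> // T tau _; rewrite !big_nil mulr0.
have [d2 [T2 [d20 T20 hd]]] : exists delta T0 : R, [/\ 0 < delta, 0 < T0 &
  forall T tau : R, T0 <= T -> bt h *
      #|` [fset k in B T | (`|fq k - fq (k + h) - tau| < delta)%R]%fset|%:R
    <= eps * #|` B T|%:R * bt h].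
  have [->|h0] := eqVneq h 0.
    exists 1, 1; split=> // T tau _.
    by rewrite /bt b_mean0 normc_sqr0 mul0r mulr0.
  have [d [T0 [d0 T00 H1]]] := shift_density l1_gt0 l2_gt0 h0 e0.
  exists d, T0; split=> // T tau TT; rewrite mulrC ler_wpM2r//; exact: H1.
have mono (g : J) (d d' T tau : R) : d <= d' ->
    (#|` [fset k in B T | (`|fq k - fq (k + g) - tau| < d)%R]%fset| <=
     #|` [fset k in B T | (`|fq k - fq (k + g) - tau| < d')%R]%fset|)%N.
  move=> dd; apply/fsubset_leq_card/fsubsetP => k; rewrite !inE/=.
  by move=> /andP[-> /= kd]; exact: lt_le_trans dd.
exists (Num.min d1 d2), (Num.max T1 T2); split.
- by rewrite lt_min d10.
- by rewrite lt_max T10.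
move=> T tau; rewrite ge_max => /andP[TT1 TT2].
rewrite !big_cons mulrDr; apply: lerD.
  apply: le_trans (hd _ tau TT2); rewrite ler_wpM2l// ler_nat mono//.
  by rewrite ge_min lexx orbT.
apply: le_trans (IH _ tau TT1); apply: ler_sum => g _.
by rewrite ler_wpM2l// ler_nat mono// ge_min lexx.
Qed.

Lemma expo_density eps : 0 < eps ->
  exists delta T0 : R, [/\ 0 < delta, 0 < T0 & forall T tau : R, T0 <= T ->
    \sum_(k <- B T) \sum_(m <- B T | `|fq k - fq m - tau| < delta)
      normc (matrix_elem l b (e k) (e m)) ^+ 2 <= eps * #|` B T|%:R].
Proof.
move=> e0; have w0 := expo_scale_gt0 l1_gt0 l2_gt0; set w := expo_scale l in w0.
(* The 2 is for the finite part and the tail, [w ^+ 2] for the normalisation in [matrix_elem_expo].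
   Below, [normsq l b + 1] bounds the total weight of the finite part and stays positive even if [b]
   has norm zero. *)
pose eta := eps / (2 * w ^+ 2).
have w20 : 0 < w ^+ 2 by rewrite exprn_gt0.
have eta0 : 0 < eta by rewrite divr_gt0// mulr_gt0.
have [H uH tail] := square_summable_tail eta0 bt_ge0 bt_sum.
have nb : 0 < normsq l b + 1 by rewrite ltr_wpDl// normsq_ge0.
have eta20 : 0 < eta / (normsq l b + 1) by rewrite divr_gt0.
have [delta [T0 [d0 T00 dens]]] := finite_shift_density H eta20.
exists delta, T0; split=> // T tau TT.
pose Q k m := `|fq k - fq m - tau| < delta.
have E k : \sum_(m <- B T | Q k m) normc (matrix_elem l b (e k) (e m)) ^+ 2 =
    w ^+ 2 * (\sum_(m <- B T | Q k m && (m - k \in H)) bt (m - k) +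
              \sum_(m <- B T | Q k m && (m - k \notin H)) bt (m - k)).
  rewrite -bigID mulr_sumr; apply: eq_bigr => m _.
  rewrite matrix_elem_expo// normc_sqrM; congr (_ * _).
  by rewrite normc_sqr/= expr0n addr0.
(* The substitution h = m - k; that k + h lies in the ball is forgotten, which only enlarges the
   sum. *)
have P1 k : \sum_(m <- B T | Q k m && (m - k \in H)) bt (m - k) <=
    \sum_(h <- H | Q k (k + h)) bt h.
  rewrite -big_filter -(big_map (fun m => m - k) xpredT bt) -[leRHS]big_filter.
  apply: sum_uniq_sub => //.
  - by rewrite map_inj_uniq ?filter_uniq ?fset_uniq// => i j /addIr.
  - exact: filter_uniq.
  - move=> h /mapP[m]; rewrite mem_filter => /andP[/andP[mQ mH] _] ->.
    by rewrite mem_filter mH addrC subrK mQ.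
have P2 k : \sum_(m <- B T | Q k m && (m - k \notin H)) bt (m - k) <= eta.
  rewrite -big_filter -(big_map (fun m => m - k) xpredT bt).
  apply: tail.
    by rewrite map_inj_uniq ?filter_uniq ?fset_uniq// => i j /addIr.
  by move=> h /mapP[m]; rewrite mem_filter => /andP[/andP[mQ mH] _] ->.
under eq_bigr do rewrite E.
rewrite -mulr_sumr big_split/=.
have S1 : \sum_(k <- B T) \sum_(m <- B T | Q k m && (m - k \in H)) bt (m - k) <=
    eta * #|` B T|%:R.
  apply: (@le_trans _ _ (\sum_(k <- B T) \sum_(h <- H | Q k (k + h)) bt h)).
    by apply: ler_sum => k _; exact: P1.
  rewrite (exchange_big_dep xpredT)//=.
  apply: (@le_trans _ _ (eta / (normsq l b + 1) * #|` B T|%:R * \sum_(h <- H) bt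
    h)).
    apply: le_trans (dens _ tau TT); apply: ler_sum => h _.
    rewrite big_const_seq iter_addr addr0 -[leLHS]mulr_natr ler_wpM2l// ler_nat.
    rewrite -size_filter; apply: uniq_leq_size.
      by rewrite filter_uniq// fset_uniq.
    by move=> k; rewrite mem_filter !inE/= => /andP[kQ ->].
  have -> : eta / (normsq l b + 1) * #|` B T|%:R * \sum_(h <- H) bt h =
    eta * #|` B T|%:R * ((\sum_(h <- H) bt h) / (normsq l b + 1)) by ring.
  apply: ler_piMr; first by rewrite mulr_ge0// ltW.
  by rewrite ler_pdivrMr// mul1r (le_trans (bt_sum uH))// lerDl.
have S2 : \sum_(k <- B T) \sum_(m <- B T | Q k m && (m - k \notin H)) bt (m - k)
  <=
    eta * #|` B T|%:R.
  apply: (@le_trans _ _ (\sum_(k <- B T) eta)).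
    by apply: ler_sum => k _; exact: P2.
  by rewrite big_const_seq count_predT iter_addr addr0 mulr_natr.
apply: (@le_trans _ _ (w ^+ 2 * (eta * #|` B T|%:R + eta * #|` B T|%:R))).
  by rewrite ler_wpM2l ?lerD// ltW.
rewrite le_eqVlt; apply/orP; left; apply/eqP; rewrite /eta.
by field; rewrite gt_eqF.
Qed.

End Density.

(** * From the centered function to the limits for the eigenbasis *)

Section QuantumErgodicity.
Variables (R : realType) (l : R * R).
Hypotheses (l1_gt0 : 0 < l.1) (l2_gt0 : 0 < l.2).
Variables (I : choiceType) (psi : I -> R * R -> R[i]) (lam : I -> R).
Hypothesis psi_basis : orthonormal_basis l psi.
Hypothesis lam_ge0 : forall n, 0 <= lam n.
Hypothesis psi_eigen : forall n, laplace_eigenfunction l (psi n) (lam n ^+ 2).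
Variable a : R * R -> R[i].
Hypothesis a_L2 : square_integrable l a.
Local Notation cj := Num.conj.

Definition torus_mean : R[i] := ((torus_area l)^-1)%:C * torus_integral l a.
Definition centered (x : R * R) : R[i] := a x - torus_mean.

Lemma square_integrable_cst (c : R[i]) : square_integrable l (fun=> c).
Proof.
by apply: torus_continuous_L2 => //; split=> x; exact: cvg_cst.
Qed.

Lemma centered_L2 : square_integrable l centered.
Proof. by apply: square_integrableB => //; exact: square_integrable_cst. Qed.

Lemma torus_inner_cstr f (c : R[i]) : square_integrable l f ->
  torus_inner l f (fun=> c) = cj c * torus_integral l f.
Proof.
move=> fi; have := square_integrable_prod fi (square_integrable_cst 1).
rewrite conjC1; under eq_fun do rewrite mulr1; move=> ti.
by rewrite -torus_integralZ// /torus_inner; under eq_fun do rewrite mulrC.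
Qed.

Lemma torus_integral_cst (c : R[i]) : torus_integral l (fun=> c) =
  c * (torus_area l)%:C.
Proof.
rewrite /torus_integral !Rintegral_cst; try exact:
  measurable_fundamental_domain.
by apply: complex_eqP; rewrite ?ReM ?ImM /= mulr0 ?subr0 ?add0r.
Qed.

Lemma centered_mean0 : torus_inner l centered (expo l 0) = 0.
Proof.
have -> : expo l 0 = fun=> (expo_scale l)%:C.
  apply/funext => x; rewrite /expo wave_cosE wave_sinE.
  have -> : phase l 0 x = 0.
    by rewrite /phase /omega1 /omega2/= !(mulr0, mul0r) addr0.
  by rewrite cos0 sin0 mulr1 mulr0.
have A0 : torus_area l != 0 by rewrite torus_areaE// mulf_neq0// gt_eqF.
rewrite torus_innerB//; last 2 first.
- exact: square_integrable_cst.
- exact: square_integrable_cst.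
rewrite !torus_inner_cstr//; last exact: square_integrable_cst.
rewrite torus_integral_cst /torus_mean -mulrBr mulrAC -rmorphM/= mulVf//.
by rewrite mul1r subrr mulr0.
Qed.

(** Makes the product of a square integrable function with [psi n] square integrable; periodicity
    carries the bound from [D] to the plane. *)
Lemma eigenfunction_bounded n : exists M, forall x, normc (psi n x) ^+ 2 <= M.
Proof.
have pf : torus_function l (psi n) by case: (psi_eigen n).
have [cr ci] := eigenfunction_continuous (psi_eigen n).
have [M1 M10 b1] := continuous_plane_bounded l cr.
have [M2 M20 b2] := continuous_plane_bounded l ci.
exists (M1 ^+ 2 + M2 ^+ 2) => x.
have [p Dp <-] := torus_function_reduce l1_gt0 l2_gt0 x pf.
have sqr_le (t M : R) : `|t| <= M -> t ^+ 2 <= M ^+ 2.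
  by move=> tM; rewrite -real_normK ?num_real// lerXn2r ?nnegrE// (le_trans _
    tM).
by rewrite normc_sqr lerD// sqr_le ?b1 ?b2.
Qed.

Lemma mul_psi_L2 f n : square_integrable l f ->
  square_integrable l (fun x => f x * psi n x).
Proof.
move=> fi; have [M bM] := eigenfunction_bounded n.
apply: (square_integrable_bounded (M := M)) => //.
exact/torus_continuous_measurable/eigenfunction_continuous/psi_eigen.
Qed.

(** By orthonormality the mean contributes on the diagonal only. So the deviations in (1) and the
    off-diagonal elements in (2) and (3) are all matrix elements of [centered]. *)
Lemma matrix_elem_centered i j : torus_inner l (fun x =>
  a x * psi i x) (psi j) =
  matrix_elem l centered (psi i) (psi j) + torus_mean * (i == j)%:R.
Proof.
have pL2 := psi_L2 psi_basis.
rewrite -(psi_orthonormal psi_basis) -torus_innerZ// /matrix_elem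
  -torus_innerD//.
- by congr torus_inner; apply/funext => x; rewrite /centered; ring.
- exact: mul_psi_L2 centered_L2.
- exact: square_integrableZ.
Qed.

Local Notation E := (eigen_fset lam).

Lemma eigen_density (eps : R) : 0 < eps ->
  exists delta T0 : R, [/\ 0 < delta, 0 < T0 & forall T tau : R, T0 <= T ->
    (eigenvalue_count lam T)%:R^-1 *
    \sum_(i <- E T) \sum_(j <- E T | `|lam i - lam j - tau| < delta)
      normc (matrix_elem l centered (psi i) (psi j)) ^+ 2 <= eps].
Proof.
move=> e0.
have [d [T0 [d0 T00 H]]] := expo_density l1_gt0 l2_gt0 centered_L2
  centered_mean0 e0.
exists d, T0; split=> // T tau TT.
rewrite (eigenvalue_countE l1_gt0 l2_gt0 psi_basis lam_ge0 psi_eigen).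
have N0 : (0 < #|` freq_ball l T|)%N.
  rewrite cardfs_gt0; apply/fset0Pn; exists 0; rewrite mem_ball//.
  apply: le_trans (le_trans (ltW T00) TT).
  by rewrite -(mulr0n 0) freqMn mul0r.
rewrite mulrC ler_pdivrMr ?ltr0n//; apply: le_trans (H _ tau TT).
exact: (matrix_elem_sum_le l1_gt0 l2_gt0 psi_basis lam_ge0 psi_eigen centered_L2
  (fun x y => `|x - y - tau| < d)).
Qed.

Let finE := finite_eigenvalues l1_gt0 l2_gt0 psi_basis lam_ge0 psi_eigen.
Let memE := mem_eigen_fset l1_gt0 l2_gt0 psi_basis lam_ge0 psi_eigen.

Lemma diagonal_sum_le (T delta : R) : 0 < delta ->
  \sum_(n \in [set n | lam n <= T])
    normc (torus_inner l (fun x => a x * psi n x) (psi n) - torus_mean) ^+ 2 <=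
  \sum_(i <- E T) \sum_(j <- E T | `|lam i - lam j - 0| < delta)
      normc (matrix_elem l centered (psi i) (psi j)) ^+ 2.
Proof.
move=> d0; rewrite fsbig_finite; last exact: finE.
rewrite -/(E T) big_seq [leRHS]big_seq.
apply: ler_sum => n nT.
rewrite -big_filter (bigD1_seq n) ?filter_uniq ?fset_uniq//; last first.
  by rewrite mem_filter nT subrr subr0 normr0 d0.
rewrite matrix_elem_centered eqxx mulr1 addrK lerDl.
by apply: sumr_ge0 => j _; exact: sqr_ge0.
Qed.

Lemma offdiagonal_sum_le (T delta tau : R) :
  \sum_(p \in [set p : I * I |
      [/\ p.1 <> p.2, lam p.1 <= T, lam p.2 <= T &
          `|lam p.1 - lam p.2 - tau| < delta]])
    normc (torus_inner l (fun x => a x * psi p.1 x) (psi p.2)) ^+ 2 <=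
  \sum_(i <- E T) \sum_(j <- E T | `|lam i - lam j - tau| < delta)
      normc (matrix_elem l centered (psi i) (psi j)) ^+ 2.
Proof.
set A := [set p | _].
pose r := [seq p <- [seq (i, j) | i <- E T, j <- E T] |
  `|lam p.1 - lam p.2 - tau| < delta].
have Ar p : A p -> p \in r.
  move=> [_ p1 p2 pd]; rewrite mem_filter pd /=; apply/allpairsP.
  by exists p; rewrite !memE; split=> //; exact: surjective_pairing.
(* Finiteness identifies the sum over [A] with a genuine finite sum, excluding the default value. *)
have finA : finite_set A by exact: sub_finite_set Ar (finite_seq r).
rewrite fsbig_finite// big_seq.
rewrite (eq_bigr (fun p => normc (matrix_elem l centered (psi p.1) (psi p.2)) ^+
  2)); last first.
  move=> p; rewrite in_fset_set// => /set_mem[/eqP pne _ _ _].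
  by rewrite matrix_elem_centered (negPf pne) mulr0 addr0.
rewrite -big_seq.
have -> : \sum_(i <- E T) \sum_(j <- E T | `|lam i - lam j - tau| < delta)
      normc (matrix_elem l centered (psi i) (psi j)) ^+ 2 =
    \sum_(p <- r) normc (matrix_elem l centered (psi p.1) (psi p.2)) ^+ 2.
  rewrite [RHS]big_filter [RHS]big_mkcond [RHS]big_allpairs_dep.
  by apply: eq_bigr => i _; rewrite [LHS]big_mkcond.
apply: sum_uniq_sub; [exact: fset_uniq| | |by move=> p; exact: sqr_ge0].
  apply/filter_uniq/allpairs_uniq; try exact: fset_uniq.
  by move=> [? ?] [? ?] _ _ [-> ->].
by move=> p; rewrite in_fset_set// => /set_mem/Ar.
Qed.

(** The upper limit is an infimum of suprema over neighbourhoods of infinity, so the single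
    neighbourhood beyond [T0] bounds it. That bound is weak, hence [eps / 2] to reach a strict
    inequality. *)
Lemma offdiagonal_limsup (eps : R) : 0 < eps -> exists2 delta : R, 0 < delta &
  forall tau : R, (limf_esup (fun T : R =>
    ((eigenvalue_count lam T)%:R^-1 *
      \sum_(p \in [set p : I * I |
          [/\ p.1 <> p.2, lam p.1 <= T, lam p.2 <= T &
              `|lam p.1 - lam p.2 - tau| < delta]])
        normc (torus_inner l (fun x => a x * psi p.1 x) (psi p.2)) ^+ 2)%:E)
    (pinfty_nbhs R) < eps%:E)%E.
Proof.
move=> e0; have e20 : 0 < eps / 2 by rewrite divr_gt0.
have [d [T0 [d0 T00 H]]] := eigen_density e20.
exists d => // tau; apply: (@le_lt_trans _ _ (eps / 2)%:E);
  last by rewrite lte_fin; lra.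
rewrite limf_esupE; apply: (@le_trans _ _ (ereal_sup
  ((fun T : R => ((eigenvalue_count lam T)%:R^-1 *
      \sum_(p \in [set p : I * I |
          [/\ p.1 <> p.2, lam p.1 <= T, lam p.2 <= T &
              `|lam p.1 - lam p.2 - tau| < d]])
        normc (torus_inner l (fun x => a x * psi p.1 x) (psi p.2)) ^+ 2)%:E)
   @` [set T | T0 < T]))).
  apply: ereal_inf_lbound; exists [set T | T0 < T] => //.
  by exists T0; split; first exact: num_real.
apply: ub_ereal_sup => _ [T TT <-]; rewrite lee_fin.
apply: le_trans (H T tau (ltW TT)).
by rewrite ler_wpM2l ?invr_ge0// offdiagonal_sum_le.
Qed.

Lemma diagonal_cvg :
  ((eigenvalue_count lam T)%:R^-1 *
    \sum_(n \in [set n | lam n <= T])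
      normc (torus_inner l (fun x => a x * psi n x) (psi n) - torus_mean) ^+ 2)
  @[T --> +oo] --> (0 : R).
Proof.
apply/cvgrPdist_le => eps e0; have [d [T0 [d0 T00 H]]] := eigen_density e0.
exists T0; split; first exact: num_real.
move=> T TT; rewrite sub0r normrN ger0_norm; last first.
  rewrite mulr_ge0 ?invr_ge0// fsbig_finite; last exact: finE.
  by apply: sumr_ge0 => j _; exact: sqr_ge0.
apply: le_trans (H T 0 (ltW TT)).
by rewrite ler_wpM2l ?invr_ge0// diagonal_sum_le.
Qed.

End QuantumErgodicity.

Theorem theorem1p5 (R : realType) (l : R * R) (hl1 : 0 < l.1) (hl2 : 0 < l.2)
    (psi : dual_lattice l -> R * R -> R[i]) (lam : dual_lattice l -> R)
    (hpsi : orthonormal_basis l psi)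
    (hlam : forall n, 0 <= lam n)
    (heig : forall n, laplace_eigenfunction l (psi n) (lam n ^+ 2))
    (a : R * R -> R[i]) (ha : torus_L2 l a) :
  [/\ ((eigenvalue_count lam Lam)%:R^-1 *
        \sum_(n \in [set n | lam n <= Lam])
          normc (torus_inner l (fun x => a x * psi n x) (psi n)
                 - ((torus_area l)^-1)%:C * torus_integral l a) ^+ 2)
        @[Lam --> +oo] --> (0 : R),
      forall eps : R, 0 < eps -> exists2 delta : R, 0 < delta &
        (limf_esup (fun Lam : R =>
          ((eigenvalue_count lam Lam)%:R^-1 *
            \sum_(p \in [set p : dual_lattice l * dual_lattice l |
                [/\ p.1 <> p.2, lam p.1 <= Lam, lam p.2 <= Lam &
                    `|lam p.1 - lam p.2| < delta]])
              normc (torus_inner l (fun x => a x * psi p.1 x) (psi p.2)) ^+ 2)%:E)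
          (pinfty_nbhs R) < eps%:E)%E &
      forall eps : R, 0 < eps -> exists2 delta : R, 0 < delta &
        forall tau : R,
        (limf_esup (fun Lam : R =>
          ((eigenvalue_count lam Lam)%:R^-1 *
            \sum_(p \in [set p : dual_lattice l * dual_lattice l |
                [/\ p.1 <> p.2, lam p.1 <= Lam, lam p.2 <= Lam &
                    `|lam p.1 - lam p.2 - tau| < delta]])
              normc (torus_inner l (fun x => a x * psi p.1 x) (psi p.2)) ^+ 2)%:E)
          (pinfty_nbhs R) < eps%:E)%E].
Proof.
have a_L2 := torus_L2_square_integrable ha.
split.
- exact: (diagonal_cvg hl1 hl2 hpsi hlam heig a_L2).
- move=> eps eps0.
  have [delta delta0 H] := offdiagonal_limsup hl1 hl2 hpsi hlam heig a_L2 eps0.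
  exists delta => //; have := H 0.
  by under [X in limf_esup X _]eq_fun do
    under [X in \sum_(_ \in X) _]eq_set do rewrite subr0.
- move=> eps eps0.
  have [delta delta0 H] := offdiagonal_limsup hl1 hl2 hpsi hlam heig a_L2 eps0.
  by exists delta.
Qed.
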